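(* Let $k$ be a field and let $H$ be a finite-dimensional Hopf algebra over $k$. Let $\phi_H(X) \in k[X]$ be the minimal polynomial of the linearly recursive sequence $\{\nu_n(H)\}_{n \ge 1}$. Then every root of $\phi_H(X)$ (in an algebraic closure of $k$) is a root of unity.
   Context: For a finite-dimensional Hopf algebra $H$ with antipode $S$ and $n \ge 1$, $\nu_n(H) = \mathrm{Tr}(S \circ P_H^{(n-1)}: H \to H) \in k$, where $P_H^{(m)}$ is the $m$-th convolution power of $\mathrm{id}_H$ ($P_H^{(0)}(h) = \varepsilon(h)1$, $P_H^{(m)}(h) = h_{(1)}\cdots h_{(m)}$ for $m \ge 1$). A sequence $\{v_n\}_{n \ge 1}$ in a $k$-vector space is linearly recursive if there is a non-zero polynomial $\sum_{i=0}^m c_iX^i \in k[X]$ with $c_0v_j + c_1v_{j+1} + \dots + c_mv_{j+m} = 0$ for all $j \ge 1$; such polynomials (together with $0$) form a non-zero ideal of $k[X]$, and its monic generator is the minimal polynomial of the sequence. The sequence $\{\nu_n(H)\}_{n\ge1}$ is known to be linearly recursive. *)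

(* Defs.v *)
From HB Require Import structures.
From Stdlib Require Import Classical.
From mathcomp Require Import all_boot all_order all_algebra all_field.

Set Implicit Arguments.
Unset Strict Implicit.
Unset Printing Implicit Defensive.

Import GRing.Theory.
Local Open Scope ring_scope.

(* Tensor product of finite-dimensional spaces: a tensor is the matrix of its
   coordinates on the elementary tensors of the library bases. The lemmas
   tlift_pure and tensor_decomp give its universal property. *)
Section Tensor.
Variable k : fieldType.

Definition tensor (U V : vectType k) := 'M[k]_(\dim {:U}, \dim {:V}).

Definition pure (U V : vectType k) (u : U) (v : V) : tensor U V :=
  \matrix_(i, j) (coord (vbasis {:U}) i u * coord (vbasis {:V}) j v).

(* The linear map on the tensor product induced by f; only meaningful for
   bilinear f. *)
Definition tlift (U V W : vectType k) (f : U -> V -> W) (t : tensor U V) : W :=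
  \sum_i \sum_j t i j *: f (vbasis {:U})`_i (vbasis {:V})`_j.

Definition tmap (U V U' V' : vectType k) (f : U -> U') (g : V -> V') :
    tensor U V -> tensor U' V' :=
  tlift (fun u v => pure (f u) (g v)).

Definition tassoc (U V W : vectType k) :
    tensor (tensor U V) W -> tensor U (tensor V W) :=
  tlift (fun t w => tlift (fun u v => pure u (pure v w)) t).

Definition tmul (A B : falgType k) (s t : tensor A B) : tensor A B :=
  tlift (fun a b => tlift (fun a' b' => pure (a * a') (b * b')) t) s.

End Tensor.

Section TensorTheory.
Variable k : fieldType.

Lemma tlift_is_linear (U V W : vectType k) (f : U -> V -> W) :
  linear (tlift f).
Proof.
move=> a s t; rewrite /tlift scaler_sumr -big_split; apply: eq_bigr => i _ /=.
rewrite scaler_sumr -big_split; apply: eq_bigr => j _ /=.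
by rewrite !mxE scalerDl scalerA.
Qed.

Lemma tlift_pure (U V W : vectType k) (f : U -> V -> W) u v :
    (forall y, linear (f^~ y)) -> (forall x, linear (f x)) ->
  tlift f (pure u v) = f u v.
Proof.
move=> fl fr.
pose fL y := GRing.isLinear.Build _ _ _ _ (f^~ y) (fl y).
pose fR x := GRing.isLinear.Build _ _ _ _ (f x) (fr x).
pose FL y : {linear U -> W} := HB.pack (f^~ y) (fL y).
pose FR x : {linear V -> W} := HB.pack (f x) (fR x).
rewrite {2}(coord_vbasis (memvf u)) -[RHS]/(FL v _) linear_sum /tlift.
apply: eq_bigr => i _; rewrite linearZ /=.
rewrite {2}(coord_vbasis (memvf v)) -[f _ _ in RHS]/(FR _ _) linear_sum.
rewrite scaler_sumr; apply: eq_bigr => j _.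
by rewrite linearZ /= mxE scalerA.
Qed.

Lemma pure_linearl (U V : vectType k) (v : V) :
  linear (fun u : U => pure u v).
Proof.
by move=> a x y; apply/matrixP=> i j; rewrite !mxE linearP mulrDl mulrA.
Qed.

Lemma pure_linearr (U V : vectType k) (u : U) : linear (@pure k U V u).
Proof.
by move=> a x y; apply/matrixP=> i j; rewrite !mxE linearP mulrDr mulrCA.
Qed.

Lemma tlift_linear_fun (U V W : vectType k) (f g h : U -> V -> W) a t :
    (forall x y, f x y = a *: g x y + h x y) ->
  tlift f t = a *: tlift g t + tlift h t.
Proof.
move=> fE; rewrite /tlift scaler_sumr -big_split; apply: eq_bigr => i _ /=.
rewrite scaler_sumr -big_split; apply: eq_bigr => j _ /=.
by rewrite fE scalerDr !scalerA [a * _]mulrC.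
Qed.

Lemma tassoc_pure (U V W : vectType k) (u : U) (v : V) (w : W) :
  tassoc (pure (pure u v) w) = pure u (pure v w).
Proof.
rewrite /tassoc tlift_pure => [|y|t]; last 2 first.
- exact: tlift_is_linear.
- move=> a x y; apply: tlift_linear_fun => u' v'.
  by rewrite !(pure_linearl, pure_linearr).
rewrite tlift_pure // => [y|x a y z]; first exact: pure_linearl.
by rewrite !(pure_linearl, pure_linearr).
Qed.

Lemma tmul_pure (A B : falgType k) (a a' : A) (b b' : B) :
  tmul (pure a b) (pure a' b') = pure (a * a') (b * b').
Proof.
rewrite /tmul tlift_pure => [|y|x]; last 2 first.
- move=> c x z; apply: tlift_linear_fun => u v.
  by rewrite mulrDl -scalerAl pure_linearl.
- move=> c y z; apply: tlift_linear_fun => u v.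
  by rewrite mulrDl -scalerAl pure_linearr.
rewrite tlift_pure // => [y|x] c z z'; rewrite mulrDr -scalerAr.
  exact: pure_linearl.
exact: pure_linearr.
Qed.

Lemma tensor_decomp (U V : vectType k) (t : tensor U V) :
  t = tlift (@pure k U V) t.
Proof.
apply/matrixP=> i j; rewrite /tlift summxE (bigD1 i) //= summxE (bigD1 j) //=.
have cE (X : vectType k) (a b : 'I_(\dim {:X})) :
    coord (vbasis {:X}) a (vbasis {:X})`_b = (a == b)%:R.
  by rewrite coord_free ?(basis_free (vbasisP _)) // eq_sym.
rewrite !mxE !cE !eqxx !mulr1 big1 => [|j' nj]; last first.
  by rewrite !mxE !cE [j == _]eq_sym (negPf nj) !mulr0.
rewrite addr0 big1 ?addr0 // => i' ni; rewrite summxE big1 // => j' _.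
by rewrite !mxE !cE [i == _]eq_sym (negPf ni) mul0r mulr0.
Qed.

End TensorTheory.

(* Finite-dimensionality is part of falgType. *)
HB.mixin Record Falgebra_isHopf (k : fieldType) H of Falgebra k H := {
  coprod : 'Hom(H, tensor H H);
  counit : 'Hom(H, k^o);
  antipode : 'End(H);
  coprodA : forall h : H,
    tassoc (tmap coprod id (coprod h)) = tmap id coprod (coprod h);
  counitl : forall h : H,
    tlift (fun x y : H => (counit x : k) *: y) (coprod h) = h;
  counitr : forall h : H,
    tlift (fun x y : H => (counit y : k) *: x) (coprod h) = h;
  coprod1 : coprod 1 = pure 1 1;
  coprodM : forall g h : H, coprod (g * h) = tmul (coprod g) (coprod h);
  counit1 : counit 1 = 1;
  counitM : forall g h : H, counit (g * h) = counit g * counit h;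
  antipodel : forall h : H,
    tlift (fun x y : H => antipode x * y) (coprod h) = (counit h : k)%:A;
  antipoder : forall h : H,
    tlift (fun x y : H => x * antipode y) (coprod h) = (counit h : k)%:A;
}.

#[short(type="hopfAlgType")]
HB.structure Definition HopfAlgebra (k : fieldType) :=
  { H of Falgebra_isHopf k H & Falgebra k H }.

Definition ltrace (k : fieldType) (V : vectType k) (f : 'End(V)) : k :=
  \tr (passmx.mxof (vbasis {:V}) (vbasis {:V}) f).

Section Indicators.
Variables (k : fieldType) (H : hopfAlgType k).

Definition convol (f g : 'End(H)) : 'End(H) :=
  linfun (fun h : H => tlift (fun x y : H => f x * g y) (coprod h)).

Definition convol_unit : 'End(H) :=
  linfun (fun h : H => (counit h : k)%:A : H).

Definition convol_pow_id (m : nat) : 'End(H) :=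
  iter m (convol \1%VF) convol_unit.

(* Meaningful for n >= 1 only. *)
Definition hopf_indicator (n : nat) : k^o :=
  ltrace (antipode \o convol_pow_id n.-1)%VF.

End Indicators.

(* Sequences are indexed by n >= 1: the value at 0 is ignored. *)
Section LinearRecursion.
Variables (k : fieldType) (V : lmodType k).
Implicit Types (v : nat -> V) (p : {poly k}).

Definition satisfies_rec v p :=
  forall j, (0 < j)%N -> \sum_(i < size p) p`_i *: v (j + i)%N = 0.

Definition linearly_recursive v := exists2 p, p != 0 & satisfies_rec v p.

Definition is_seq_minpoly v p :=
  p \is monic /\ forall q, satisfies_rec v q <-> p %| q.

End LinearRecursion.

Section SequenceMinpoly.
Variables (k : fieldType) (V : lmodType k).
Implicit Types (v : nat -> V) (p q : {poly k}).

Lemma satisfies_rec_widen v p n : (size p <= n)%N ->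
  satisfies_rec v p <->
  forall j, (0 < j)%N -> \sum_(i < n) p`_i *: v (j + i)%N = 0.
Proof.
move=> le_pn.
have E j : \sum_(i < n) p`_i *: v (j + i)%N =
           \sum_(i < size p) p`_i *: v (j + i)%N.
  rewrite [RHS](big_ord_widen n (fun i => p`_i *: v (j + i)%N)) //
    [RHS]big_mkcond.
  apply: eq_bigr => i _; case: ltnP => // le_pi.
  by rewrite nth_default // scale0r.
by split=> vp j j_gt0; [rewrite E | rewrite -E]; apply: vp.
Qed.

Lemma satisfies_recD v p q :
  satisfies_rec v p -> satisfies_rec v q -> satisfies_rec v (p + q).
Proof.
pose n := maxn (size p) (size q).
move=> /(satisfies_rec_widen v (leq_maxl _ _ : (_ <= n)%N)) vp.
move=> /(satisfies_rec_widen v (leq_maxr _ _ : (_ <= n)%N)) vq.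
apply/(satisfies_rec_widen v (size_polyD p q)) => j j_gt0.
under eq_bigr => i _ do rewrite coefD scalerDl.
by rewrite big_split /= vp // vq // addr0.
Qed.

Lemma satisfies_recZ v c p : satisfies_rec v p -> satisfies_rec v (c *: p).
Proof.
move=> vp; apply/(satisfies_rec_widen v (size_scale_leq c p)) => j j_gt0.
under eq_bigr => i _ do rewrite coefZ -scalerA.
by rewrite -scaler_sumr vp // scaler0.
Qed.

Lemma satisfies_recMX v p : satisfies_rec v p -> satisfies_rec v (p * 'X).
Proof.
move=> vp.
have le_s : (size (p * 'X)%R <= (size p).+1)%N.
  by rewrite (leq_trans (size_polyMleq _ _)) // size_polyX addn2.
apply/(satisfies_rec_widen v le_s) => j j_gt0.
rewrite big_ord_recl coefMX eqxx scale0r add0r.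
under eq_bigr => i _ do rewrite coefMX /= /bump /= add1n addnS -addSn.
exact: vp.
Qed.

Lemma satisfies_recM v p q : satisfies_rec v p -> satisfies_rec v (q * p).
Proof.
move=> vp; elim/poly_ind: q => [|q c IHq].
  by rewrite mul0r => j _; rewrite size_poly0 big_ord0.
rewrite mulrDl mul_polyC -mulrA ['X * p]mulrC mulrA.
exact/satisfies_recD/satisfies_recZ/vp/satisfies_recMX.
Qed.

Lemma seq_minpoly_exists v :
  linearly_recursive v -> exists p, is_seq_minpoly v p.
Proof.
case=> p0 p0_neq0 vp0.
suff min n p : (size p <= n)%N -> p != 0 -> satisfies_rec v p ->
    exists p', is_seq_minpoly v p' by exact: min (leqnn _) p0_neq0 vp0.
elim: n p => [|n IHn] p le_pn p_neq0 vp.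
  by rewrite -size_poly_eq0 -leqn0 le_pn in p_neq0.
case: (classic (exists q, [/\ (size q < size p)%N, q != 0
                            & satisfies_rec v q])) => [[q [lt_qp q0 vq]]|noq].
  by apply: IHn q0 vq; rewrite -ltnS (leq_trans lt_qp).
have lc0 : lead_coef p != 0 by rewrite lead_coef_eq0.
exists ((lead_coef p)^-1 *: p); split.
  by rewrite monicE lead_coefZ mulVf.
move=> q; rewrite dvdpZl ?invr_eq0 //; split=> [vq | /dvdpP[r ->]]; last first.
  exact: satisfies_recM.
apply/modp_eq0P; apply: NNPP => /eqP r_neq0; apply: noq; exists (q %% p).
split=> //; first by rewrite ltn_modp.
have ->: q %% p = q + (- (q %/ p)) * p.
  by rewrite {2}(divp_eq q p) mulNr addrAC subrr add0r.
exact/satisfies_recD/satisfies_recM.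
Qed.

Lemma seq_minpoly_unique v p q :
  is_seq_minpoly v p -> is_seq_minpoly v q -> p = q.
Proof.
move=> [p_mon vp] [q_mon vq]; apply/eqP; rewrite -eqp_monic //.
by apply/andP; split; [apply/vp/vq | apply/vq/vp].
Qed.

End SequenceMinpoly.

Section IndicatorRecursive.
Variables (k : fieldType) (H : hopfAlgType k).

Lemma convolE (f g : 'End(H)) h :
  convol f g h = tlift (fun x y : H => f x * g y) (coprod h).
Proof.
have lin : linear (fun h : H => tlift (fun x y : H => f x * g y) (coprod h)).
  by move=> a x y; rewrite linearP tlift_is_linear.
pose b := GRing.isLinear.Build _ _ _ _ _ lin.
pose F : {linear H -> H} := HB.pack (fun h : H => _) b.
exact: (lfunE F).
Qed.

Lemma convol_unitE h : convol_unit H h = (counit h : k)%:A.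
Proof.
have lin : linear (fun h : H => (counit h : k)%:A : H).
  by move=> a x y; rewrite linearP scalerDl scalerA.
pose b := GRing.isLinear.Build _ _ _ _ _ lin.
pose F : {linear H -> H} := HB.pack (fun h : H => _) b.
exact: (lfunE F).
Qed.

Lemma convol_linear (f : 'End(H)) : linear (convol f).
Proof.
move=> a g1 g2; apply/lfunP => h; rewrite add_lfunE scale_lfunE !convolE.
rewrite /tlift scaler_sumr -big_split; apply: eq_bigr => i _ /=.
rewrite scaler_sumr -big_split; apply: eq_bigr => j _ /=.
rewrite add_lfunE scale_lfunE mulrDr scalerDr -scalerAr !scalerA.
by rewrite [a * _]mulrC.
Qed.

Lemma hopf_indicator_recursive : linearly_recursive (@hopf_indicator k H).
Proof.
pose d := \dim {:'End(H)}; pose P := @convol_pow_id k H.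
pose X := [tuple P i | i < d.+1].
have XE (i : 'I_d.+1) : X`_i = P i by rewrite -tnth_nth tnth_mktuple.
have [c c0 [i0 ci0]] : exists2 c : 'I_d.+1 -> k,
    \sum_i c i *: P i = 0 & exists i, c i != 0.
  apply: NNPP => noc; suff /eqP dX : free X.
    by have := dimvS (subvf <<X>>%VS); rewrite dX size_tuple ltnn.
  apply/freeP=> c c0 i; apply: NNPP => /eqP ci; apply: noc; exists c.
    by under eq_bigr => l _ do rewrite -XE.
  by exists i.
have ltr (f g : 'End(H)) a : ltrace (antipode \o (a *: f + g))%VF =
    a * ltrace (antipode \o f)%VF + ltrace (antipode \o g)%VF.
  by rewrite comp_lfunDr -comp_lfunZr /ltrace passmx.mxof_linear linearP.
pose T f : k^o := ltrace ((antipode : 'End(H)) \o f)%VF.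
have T_lin : linear T by move=> a f g; rewrite /T ltr.
pose bT := GRing.isLinear.Build _ _ _ _ _ T_lin.
pose TL : {linear 'End(H) -> k^o} := HB.pack T bT.
pose L : 'End(H) -> 'End(H) := convol \1%VF.
pose bL := GRing.isLinear.Build _ _ _ _ L (@convol_linear \1%VF).
pose LL : {linear 'End(H) -> 'End(H)} := HB.pack L bL.
have shift j : \sum_i c i *: P (j + i)%N = 0.
  elim: j => [|j IHj]; first exact: c0.
  rewrite -[RHS](linear0 LL) -[in RHS]IHj linear_sum; apply: eq_bigr => i _.
  by rewrite linearZ.
pose p := \poly_(i < d.+1) c (inord i).
exists p.
  apply: contraNneq ci0 => p0; have := coef0 k i0.
  by rewrite -p0 coef_poly ltn_ord inord_val => ->.
apply/(satisfies_rec_widen _ (size_poly _ _)) => -[//|j] _.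
rewrite -[RHS](linear0 TL) -[in RHS](shift j) linear_sum; apply: eq_bigr => i _.
by rewrite linearZ /= coef_poly ltn_ord inord_val.
Qed.

End IndicatorRecursive.

(* Main.v *)
(* By Cayley-Hamilton, phi divides the characteristic polynomial of the operator
   N : x (x) y |-> x_1 (x) x_2 y of H (x) H, since N^m (x (x) 1) = x_1 (x) P^(m)(x_2).
   As S is bijective, N is conjugate to the inverse of Theta : x (x) y |-> x_1 (x) y x_2,
   which is the canonical automorphism theta : m |-> m_1 m_0 of a free anti-Yetter-Drinfeld
   module. Restricting to an eigenspace over L, let M be any anti-Yetter-Drinfeld module
   of dimension d > 0 on which theta is a scalar a, and n = dim H. On H (x) M, with
     T : h (x) m |-> h m_1 (x) m_0,    P : h (x) m |-> h_2 (x) h_1 m,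
     Y : h (x) m |-> m_1 h (x) m_0,    J : h (x) m |-> h_1 (x) h_2 m,
   one has P T = Y (S^2 (x) theta) J. The determinants of T, P, Y, J are n-th roots of
   unity, as one sees by tensoring with a regular (co)module, so
   a^(n n d) det(S^2)^(n d) = 1. Since a = 1 occurs (1 (x) 1 is fixed by Theta), det(S^2)
   is a root of unity, and therefore so is every eigenvalue of Theta. *)
Require Import Defs.
From HB Require Import structures.
From mathcomp Require Import all_boot all_order all_algebra all_field.
From mathcomp.real_closed Require Import mxtens.

Set Implicit Arguments.
Unset Strict Implicit.
Unset Printing Implicit Defensive.

Import GRing.Theory.
Local Open Scope ring_scope.

(** The determinant of Theta alone would only constrain the product of its eigenvalues.
    Anti-Yetter-Drinfeld modules isolate each one: theta commutes with the action and the coaction,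
    so the part of the module belonging to one eigenvalue is again such a module, and there the
    determinant identity involves only a and det(S^2).

    Roots of unity arise as follows. For commuting module and comodule structures R and C on one
    space, the canonical operator X = sum R(e_l) C_l is conjugated by invertible J, Y to 1 (x) X up
    to reordering, so det J and det Y cancel and det X ^+ n = 1 remains, n being the dimension of
    the regular factor. The operators Y and J are such X themselves. T and P have the wrong
    handedness: it is their inverses, written with S^-1, that are canonical. This is why S must be
    bijective, which is obtained by comparing ranks in a pentagon equation, without integrals.

    Modules are spaces of column vectors over L, with Kronecker products as tensor products, while H
    remains over k. *)

Section TensMx.
Variable R : comNzRingType.

Lemma tensmxDl m n p q (A B : 'M[R]_(m, n)) (C : 'M[R]_(p, q)) :
  (A + B) *t C = A *t C + B *t C.
Proof. by apply/matrixP=> i j; rewrite !mxE mulrDl. Qed.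

Lemma tensmxDr m n p q (A : 'M[R]_(m, n)) (B C : 'M[R]_(p, q)) :
  A *t (B + C) = A *t B + A *t C.
Proof. by apply/matrixP=> i j; rewrite !mxE mulrDr. Qed.

Lemma tensmxZl m n p q a (A : 'M[R]_(m, n)) (B : 'M[R]_(p, q)) :
  (a *: A) *t B = a *: (A *t B).
Proof. by apply/matrixP=> i j; rewrite !mxE mulrA. Qed.

Lemma tensmxZr m n p q a (A : 'M[R]_(m, n)) (B : 'M[R]_(p, q)) :
  A *t (a *: B) = a *: (A *t B).
Proof. by apply/matrixP=> i j; rewrite !mxE mulrCA. Qed.

Lemma tensmx_suml (I : Type) (r : seq I) (P : pred I) m n p q
    (A : I -> 'M[R]_(m, n)) (B : 'M[R]_(p, q)) :
  (\sum_(i <- r | P i) A i) *t B = \sum_(i <- r | P i) A i *t B.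
Proof.
apply: (big_morph (fun A => A *t B)); last exact: tens0mx.
by move=> ? ?; exact: tensmxDl.
Qed.

Lemma tensmx_sumr (I : Type) (r : seq I) (P : pred I) m n p q
    (A : 'M[R]_(m, n)) (B : I -> 'M[R]_(p, q)) :
  A *t (\sum_(i <- r | P i) B i) = \sum_(i <- r | P i) A *t B i.
Proof.
apply: (big_morph (fun B => A *t B)); last exact: tensmx0.
by move=> ? ?; exact: tensmxDr.
Qed.

Lemma tensmx11 m n : 1%:M *t 1%:M = 1%:M :> 'M[R]_(m * n).
Proof.
apply/matrixP=> i j; case: (mxtens_indexP i) => i1 i2.
case: (mxtens_indexP j) => j1 j2.
rewrite tensmxE !mxE (can_eq (@mxtens_indexK _ _)) xpair_eqE.
by rewrite -natrM mulnb.
Qed.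

Lemma det_castmx m n (e1 e2 : m = n) (A : 'M[R]_m) :
  \det (castmx (e1, e2) A) = \det A.
Proof. by case: _ / e1 in e2 *; rewrite (eq_axiomK e2) castmx_id. Qed.

Lemma det_tens1mx n m (X : 'M[R]_m) : \det ((1%:M : 'M_n) *t X) = \det X ^+ n.
Proof.
elim: n => [|n IHn]; first by rewrite expr0 det_mx00.
rewrite -[n.+1]/(1 + n)%N (@scalar_mx_block _ 1 n) tens_block_mx det_castmx.
rewrite !tens0mx (det_ublock (_ *t X)) IHn tens_scalar1mx det_castmx.
by rewrite exprS.
Qed.

(** The permutation matrix of the flip of the two tensor factors. *)
Definition tens_swap m n : 'M[R]_(m * n, n * m) :=
  \matrix_(i, j) (((mxtens_unindex i).1 == (mxtens_unindex j).2) &&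
                  ((mxtens_unindex i).2 == (mxtens_unindex j).1))%:R.

Lemma tens_swapE m n p q (A : 'M[R]_(m, n)) (B : 'M[R]_(p, q)) :
  (A *t B) *m tens_swap n q = tens_swap m p *m (B *t A).
Proof.
have idx a b (i : 'I_a) (j : 'I_b) k :
    ((i == (mxtens_unindex k).2) && (j == (mxtens_unindex k).1))
    = (k == mxtens_index (j, i)).
  by case: (mxtens_indexP k) => u v;
     rewrite mxtens_indexK (can_eq (@mxtens_indexK _ _)) xpair_eqE andbC
             ![_ == u]eq_sym ![_ == v]eq_sym.
apply/matrixP=> i j; case: (mxtens_indexP i) => i1 i2.
case: (mxtens_indexP j) => j1 j2; rewrite !mxE.
rewrite (bigD1 (mxtens_index (j2, j1))) //= big1 => [|k nk]; last first.
  rewrite !mxE mxtens_indexK; case: (mxtens_indexP k) nk => k1 k2.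
  rewrite (can_eq (@mxtens_indexK _ _)) xpair_eqE !mxtens_indexK /=.
  by move/negPf->; rewrite mulr0.
rewrite (bigD1 (mxtens_index (i2, i1))) //= big1 => [|k nk]; last first.
  rewrite !mxE mxtens_indexK; case: (mxtens_indexP k) nk => k1 k2.
  rewrite (can_eq (@mxtens_indexK _ _)) xpair_eqE !mxtens_indexK /=.
  by rewrite andbC ![i1 == _]eq_sym ![i2 == _]eq_sym => /negPf->; rewrite mul0r.
by rewrite !mxE !mxtens_indexK /= !eqxx mulr1 mul1r !addr0 mulrC.
Qed.

Lemma tens_swapK m n : tens_swap m n *m tens_swap n m = 1%:M.
Proof.
apply/matrixP=> i j; case: (mxtens_indexP i) => i1 i2.
case: (mxtens_indexP j) => j1 j2; rewrite !mxE.
rewrite (bigD1 (mxtens_index (i2, i1))) //= big1 => [|k nk]; last first.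
  rewrite !mxE mxtens_indexK; case: (mxtens_indexP k) nk => k1 k2.
  rewrite (can_eq (@mxtens_indexK _ _)) xpair_eqE !mxtens_indexK /=.
  by rewrite andbC ![i1 == _]eq_sym ![i2 == _]eq_sym => /negPf->; rewrite mul0r.
rewrite !mxE !mxtens_indexK /= !eqxx mul1r addr0.
by rewrite (can_eq (@mxtens_indexK _ _)) xpair_eqE andbC.
Qed.

Lemma det_tensmx1 n m (X : 'M[R]_m) : \det (X *t (1%:M : 'M_n)) = \det X ^+ n.
Proof.
rewrite -det_tens1mx; have := tens_swapE X (1%:M : 'M_n).
have := tens_swapK m n.
(* The flips are not square by type; identifying the two sizes makes their determinants
   available. *)
move: (X *t _) (_ *t X) (tens_swap m n) (tens_swap n m); rewrite [(n * m)%N]mulnC.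
move=> A B P Q PQ /(congr1 (mulmx^~ Q)); rewrite -!mulmxA PQ mulmx1 => ->.
by rewrite !det_mulmx mulrCA -det_mulmx PQ det1 mulr1.
Qed.
End TensMx.

(** * Maps from k-spaces to L-spaces, semilinear along [iota] *)

Section Semilinear.
Variables (k : fieldType) (L : fieldType) (iota : {rmorphism k -> L}).
Implicit Types (V : lmodType k) (W : lmodType L).

(** Eigenvalues lie in L. Using semilinear maps out of H avoids building the Hopf algebra obtained
    from H by extension of scalars. *)
Definition klin (V : lmodType k) (W : lmodType L) (f : V -> W) :=
  forall a x y, f (a *: x + y) = iota a *: f x + f y.

Lemma klin0 V W (f : V -> W) : klin f -> f 0 = 0.
Proof.
move=> lf; have := lf (-1) 0 0.
by rewrite scaler0 addr0 rmorphN1 scaleN1r addNr.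
Qed.

Lemma klinD V W (f : V -> W) : klin f -> {morph f : x y / x + y}.
Proof. by move=> lf x y; rewrite -[x]scale1r lf rmorph1 !scale1r. Qed.

Lemma klinZ V W (f : V -> W) : klin f -> forall a x, f (a *: x) = iota a *: f x.
Proof. by move=> lf a x; rewrite -[a *: x]addr0 lf (klin0 lf) addr0. Qed.

Lemma klin_sumE V W (f : V -> W) (I : Type) (r : seq I) (P : pred I) F :
  klin f -> f (\sum_(i <- r | P i) F i) = \sum_(i <- r | P i) f (F i).
Proof.
by move=> lf; apply: (big_morph f (klinD lf) (klin0 lf)).
Qed.

Lemma klin_sum V W (I : Type) (r : seq I) (P : pred I) (f : I -> V -> W) :
  (forall i, klin (f i)) -> klin (fun x => \sum_(i <- r | P i) f i x).
Proof.
move=> lf a x y; rewrite scaler_sumr -big_split.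
by apply: eq_bigr => i _; apply: lf.
Qed.

Lemma klinZf V W (c : L) (f : V -> W) : klin f -> klin (fun x => c *: f x).
Proof. by move=> lf a x y; rewrite lf scalerDr !scalerA mulrC. Qed.

Lemma klin_scalel (V : lmodType k) (W : lmodType L) (c : V -> k) (B : W) :
  (forall a x y, c (a *: x + y) = a * c x + c y) -> klin (fun x => iota (c x) *: B).
Proof. by move=> lc a x y; rewrite lc rmorphD rmorphM scalerDl scalerA. Qed.

Lemma klin_mulmxl V m p q (f : V -> 'M[L]_(m, p)) (B : 'M_(p, q)) :
  klin f -> klin (fun x => f x *m B).
Proof. by move=> lf a x y; rewrite lf mulmxDl scalemxAl. Qed.

Lemma klin_mulmxr V m p q (A : 'M_(m, p)) (f : V -> 'M[L]_(p, q)) :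
  klin f -> klin (fun x => A *m f x).
Proof. by move=> lf a x y; rewrite lf mulmxDr scalemxAr. Qed.

Lemma klin_tensl V m n p q (f : V -> 'M[L]_(m, n)) (B : 'M_(p, q)) :
  klin f -> klin (fun x => f x *t B).
Proof. by move=> lf a x y; rewrite lf tensmxDl tensmxZl. Qed.

Lemma klin_tensr V m n p q (A : 'M_(m, n)) (f : V -> 'M[L]_(p, q)) :
  klin f -> klin (fun x => A *t f x).
Proof. by move=> lf a x y; rewrite lf tensmxDr tensmxZr. Qed.

Section Lift.
Variables (U V : vectType k) (W : lmodType L).

Definition liftL (f : U -> V -> W) (t : tensor U V) : W :=
  \sum_i \sum_j iota (t i j) *: f (vbasis {:U})`_i (vbasis {:V})`_j.

Lemma liftL_klin f : klin (liftL f).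
Proof.
move=> a s t; rewrite /liftL scaler_sumr -big_split; apply: eq_bigr => i _ /=.
rewrite scaler_sumr -big_split; apply: eq_bigr => j _ /=.
by rewrite !mxE rmorphD rmorphM scalerDl scalerA.
Qed.

Lemma eq_liftL f g t : (forall x y, f x y = g x y) -> liftL f t = liftL g t.
Proof.
by move=> fg; apply: eq_bigr => i _; apply: eq_bigr => j _; rewrite fg.
Qed.

Lemma klin_liftLf (X : lmodType k) (f : X -> U -> V -> W) t :
  (forall u v, klin (fun x => f x u v)) -> klin (fun x => liftL (f x) t).
Proof.
by move=> lf; do 2!apply: klin_sum => ?; apply: klinZf.
Qed.

End Lift.

Lemma klin_basis (V : vectType k) W (f : V -> W) v : klin f ->
  f v = \sum_i iota (coord (vbasis {:V}) i v) *: f (vbasis {:V})`_i.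
Proof.
move=> lf; rewrite {1}(coord_vbasis (memvf v)) klin_sumE //.
by apply: eq_bigr => i _; rewrite (klinZ lf).
Qed.

Lemma liftL_pure (U V : vectType k) W (f : U -> V -> W) u v :
    (forall y, klin (f^~ y)) -> (forall x, klin (f x)) ->
  liftL f (pure u v) = f u v.
Proof.
move=> fl fr; rewrite [RHS](@klin_basis _ _ (f^~ v)) //.
apply: eq_bigr => i _; rewrite [f _ v](@klin_basis _ _ (f _)) // scaler_sumr.
by apply: eq_bigr => j _; rewrite mxE rmorphM scalerA.
Qed.

Lemma liftL_tlift (U V U' V' : vectType k) W (f : U -> V -> W)
    (g : U' -> V' -> tensor U V) s :
  liftL f (tlift g s) = liftL (fun u v => liftL f (g u v)) s.
Proof.
rewrite /tlift klin_sumE; last exact: liftL_klin.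
apply: eq_bigr => i _; rewrite klin_sumE; last exact: liftL_klin.
by apply: eq_bigr => j _; rewrite klinZ //; exact: liftL_klin.
Qed.

Lemma klin_tlift (U V X : vectType k) W (f : X -> W) (g : U -> V -> X) s :
  klin f -> f (tlift g s) = liftL (fun u v => f (g u v)) s.
Proof.
move=> lf; rewrite /tlift klin_sumE //.
apply: eq_bigr => i _; rewrite klin_sumE //.
by apply: eq_bigr => j _; rewrite (klinZ lf).
Qed.

Definition ext (V : vectType k) (W : lmodType L) (f : V -> W) v : W :=
  \sum_i iota (coord (vbasis {:V}) i v) *: f (vbasis {:V})`_i.

Lemma ext_klin (V : vectType k) W f : klin (@ext V W f).
Proof.
move=> a x y; rewrite scaler_sumr -big_split; apply: eq_bigr => i _ /=.
by rewrite linearP rmorphD rmorphM scalerDl scalerA.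
Qed.

Lemma coord_vbasis_elt (V : vectType k) (i j : 'I_(\dim {:V})) :
  coord (vbasis {:V}) i (vbasis {:V})`_j = (i == j)%:R.
Proof. by rewrite coord_free ?(basis_free (vbasisP _)) // eq_sym. Qed.

Lemma ext_basis (V : vectType k) W (f : V -> W)
    (i : 'I_(\dim {:V})) : ext f (vbasis {:V})`_i = f (vbasis {:V})`_i.
Proof.
rewrite /ext (bigD1 i) //= coord_vbasis_elt eqxx rmorph1 scale1r big1 ?addr0 //.
by move=> j nj; rewrite coord_vbasis_elt (negPf nj) rmorph0 scale0r.
Qed.

End Semilinear.

(** * Sweedler notation *)

Section Sweedler.
Variables (k : fieldType) (H : hopfAlgType k).
Variables (L : fieldType) (iota : {rmorphism k -> L}).
Implicit Type W : lmodType L.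

Local Notation n := (\dim {:H}).
Local Notation e i := (vbasis {:H})`_i.
Local Notation S := (@antipode k H).
Local Notation klin := (klin iota).

(* sum f(h_1, h_2). Since f is only evaluated at basis vectors, coassociativity and
   the exchange lemmas below need no linearity of f. *)
Definition sweedler W (f : H -> H -> W) (h : H) : W := liftL iota f (coprod h).

Local Notation sw := sweedler.

Lemma eq_sw W (f g : H -> H -> W) h :
  (forall x y, f x y = g x y) -> sw f h = sw g h.
Proof. exact: eq_liftL. Qed.

Lemma klin_sw W (f : H -> H -> W) : klin (sw f).
Proof. by move=> a x y; rewrite /sweedler linearP; apply: liftL_klin. Qed.

Lemma klin_swf (V : lmodType k) W (f : V -> H -> H -> W) h :
  (forall u v, klin (fun x => f x u v)) -> klin (fun x => sw (f x) h).
Proof. exact: klin_liftLf. Qed.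

Lemma sw_coassoc W (f : H -> H -> H -> W) h :
  sw (fun x y => sw (fun a b => f a b y) x) h =
  sw (fun x y => sw (fun a b => f x a b) y) h.
Proof.
(* The linear extension of f from the basis reduces to the trilinear case. *)
pose g a b c := ext iota (fun a => ext iota (fun b => ext iota (f a b) c) b) a.
have gE (i j l : 'I_n) : g (e i) (e j) (e l) = f (e i) (e j) (e l).
  by rewrite /g !ext_basis.
have g1 b c : klin (fun a => g a b c) by move=> *; apply: ext_klin.
have g3 a b : klin (fun c => g a b c).
  by do 2!(apply: klin_sum => ?; apply: klinZf); apply: ext_klin.
transitivity (sw (fun x y => sw (fun a b => g a b y) x) h).
  apply: eq_bigr => i _; apply: eq_bigr => j _; congr (_ *: _).
  by apply: eq_bigr => p _; apply: eq_bigr => q _; rewrite gE.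
transitivity (sw (fun x y => sw (fun a b => g x a b) y) h); last first.
  apply: eq_bigr => i _; apply: eq_bigr => j _; congr (_ *: _).
  by apply: eq_bigr => p _; apply: eq_bigr => q _; rewrite gE.
have g2 a c : klin (fun b => g a b c).
  by apply: klin_sum => ?; apply: klinZf; apply: ext_klin.
pose G u t := liftL iota (g u) t.
have Gl t : klin (G^~ t) by apply: klin_liftLf.
have Gr u : klin (G u) by apply: liftL_klin.
have Gp u v w : liftL iota G (pure u (pure v w)) = g u v w.
  by rewrite liftL_pure // /G liftL_pure.
have := congr1 (liftL iota G) (coprodA h).
rewrite /tassoc /tmap !liftL_tlift => E.
transitivity (liftL iota (fun u v : H => liftL iota G (pure u (coprod v)))
  (coprod h)); last by apply: eq_liftL => u v; rewrite liftL_pure.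
rewrite -{}E; apply: eq_liftL => u v; rewrite liftL_pure; last first.
- move=> t a x y; rewrite !liftL_tlift.
  apply: (@klin_liftLf _ _ iota H H W H (fun y u v =>  liftL iota G (pure u (pure v y)))).
  by move=> p q a' x' y'; rewrite !Gp g3.
- by move=> y a x x'; rewrite !liftL_tlift; apply: liftL_klin.
by rewrite liftL_tlift; apply: eq_liftL => a b; rewrite Gp.
Qed.

Lemma sw_counitl W (f : H -> W) h :
  klin f -> sw (fun x y => iota (counit x) *: f y) h = f h.
Proof.
move=> lf; rewrite -[in RHS](counitl h) (klin_tlift _ _ lf).
by apply: eq_liftL => x y; rewrite (klinZ lf).
Qed.

Lemma sw_counitr W (f : H -> W) h :
  klin f -> sw (fun x y => iota (counit y) *: f x) h = f h.
Proof.
move=> lf; rewrite -[in RHS](counitr h) (klin_tlift _ _ lf).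
by apply: eq_liftL => x y; rewrite (klinZ lf).
Qed.

Lemma sw_antil W (f : H -> W) h :
  klin f -> sw (fun x y => f (S x * y)) h = iota (counit h) *: f 1.
Proof. by move=> lf; rewrite -(klinZ lf) -antipodel (klin_tlift _ _ lf). Qed.

Lemma sw_antir W (f : H -> W) h :
  klin f -> sw (fun x y => f (x * S y)) h = iota (counit h) *: f 1.
Proof. by move=> lf; rewrite -(klinZ lf) -antipoder (klin_tlift _ _ lf). Qed.

Lemma sw1 W (f : H -> H -> W) :
  (forall y, klin (f^~ y)) -> (forall x, klin (f x)) -> sw f 1 = f 1 1.
Proof. by move=> fl fr; rewrite /sweedler coprod1 liftL_pure. Qed.

Lemma swM W (f : H -> H -> W) g h :
    (forall y, klin (f^~ y)) -> (forall x, klin (f x)) ->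
  sw f (g * h) = sw (fun x y => sw (fun u v => f (x * u) (y * v)) h) g.
Proof.
move=> fl fr; rewrite /sweedler coprodM /tmul liftL_tlift.
apply: eq_liftL => x y; rewrite liftL_tlift; apply: eq_liftL => u v.
by rewrite liftL_pure.
Qed.

Lemma linear_sw W W' (phi : W -> W') (f : H -> H -> W) h :
  linear phi -> phi (sw f h) = sw (fun x y => phi (f x y)) h.
Proof.
move=> lphi; pose b := GRing.isLinear.Build _ _ _ _ _ lphi.
pose F : {linear W -> W'} := HB.pack phi b.
rewrite -[phi]/(F : W -> W') /sweedler /liftL linear_sum; apply: eq_bigr => i _.
by rewrite linear_sum; apply: eq_bigr => j _; rewrite linearZ.
Qed.

Lemma sw_mulmxl m p q (A : 'M[L]_(m, p)) (f : H -> H -> 'M_(p, q)) h :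
  A *m sw f h = sw (fun x y => A *m f x y) h.
Proof. by apply: linear_sw => a B C; rewrite linearP. Qed.

Lemma sw_mulmxr m p q (f : H -> H -> 'M_(m, p)) (A : 'M[L]_(p, q)) h :
  sw f h *m A = sw (fun x y => f x y *m A) h.
Proof.
by apply: (@linear_sw _ _ (mulmx^~ A)) => a B C; rewrite mulmxDl scalemxAl.
Qed.

Lemma sw_tensr m n p q (A : 'M[L]_(m, n)) (f : H -> H -> 'M_(p, q)) h :
  A *t sw f h = sw (fun x y => A *t f x y) h.
Proof. by apply: linear_sw => a B C; rewrite tensmxDr tensmxZr. Qed.

Lemma sw_tensl m n p q (f : H -> H -> 'M_(m, n)) (A : 'M[L]_(p, q)) h :
  sw f h *t A = sw (fun x y => f x y *t A) h.
Proof.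
by apply: (@linear_sw _ _ (fun B => B *t A)) => a B C; rewrite tensmxDl tensmxZl.
Qed.

Lemma sw_scale W (c : L) (f : H -> H -> W) h :
  c *: sw f h = sw (fun x y => c *: f x y) h.
Proof.
apply: (@linear_sw _ _ ( *:%R c)) => a B C.
by rewrite scalerDr !scalerA mulrC.
Qed.

Lemma sw_sum W (I : Type) (r : seq I) (P : pred I) (f : I -> H -> H -> W) h :
  \sum_(i <- r | P i) sw (f i) h = sw (fun x y => \sum_(i <- r | P i) f i x y) h.
Proof.
rewrite /sweedler /liftL exchange_big; apply: eq_bigr => i _ /=.
by rewrite exchange_big; apply: eq_bigr => j _ /=; rewrite scaler_sumr.
Qed.

Lemma sw_sw W (f : H -> H -> H -> H -> W) g h :
  sw (fun x y => sw (f x y) h) g = sw (fun u v => sw (fun x y => f x y u v) g) h.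
Proof.
rewrite -sw_sum; apply: eq_bigr => i _ /=; rewrite -sw_sum; apply: eq_bigr => j _.
by rewrite sw_scale.
Qed.

End Sweedler.

Arguments sw_coassoc {k H L iota W} f h.
Arguments sw_counitl {k H L iota W} f h _.
Arguments sw_counitr {k H L iota W} f h _.
Arguments sw_antil {k H L iota W} f h _.
Arguments sw_antir {k H L iota W} f h _.
Arguments sw1 {k H L iota W} f _ _.
Arguments swM {k H L iota W} f g h _ _.
Arguments sw_sw {k H L iota W} f g h.
Arguments eq_sw {k H L iota W f} g {h} _.

Section SweedlerSelf.
Variables (k : fieldType) (H : hopfAlgType k).

Lemma klin_sw_id (L : fieldType) (iota : {rmorphism k -> L}) (W : lmodType L)
    (V : lmodType k) (f : V -> W) (g : H -> H -> V) h :
  klin iota f -> f (sweedler idfun g h) = sweedler iota (fun x y => f (g x y)) h.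
Proof.
move=> lf; rewrite /sweedler /liftL (klin_sumE _ _ _ lf); apply: eq_bigr => i _.
by rewrite (klin_sumE _ _ _ lf); apply: eq_bigr => j _; rewrite (klinZ lf).
Qed.

End SweedlerSelf.

Section KlinComp.
Variables (k : fieldType) (L : fieldType) (iota : {rmorphism k -> L}).

Lemma klin_comp (U V : lmodType k) (W : lmodType L) (f : V -> W) (g : U -> V) :
  linear g -> klin iota f -> klin iota (fun x => f (g x)).
Proof. by move=> lg lf a x y; rewrite lg lf. Qed.

Lemma linear_klin (U V : lmodType k) (f : U -> V) :
  linear f -> @klin k k idfun U V f.
Proof. by []. Qed.

Lemma linear_id (U : lmodType k) : linear (fun x : U => x).
Proof. by []. Qed.

End KlinComp.

(** * Automatic proofs of linearity and semilinearity *)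

Ltac solve_linear :=
  let a := fresh "a" in let x := fresh "x" in let y := fresh "y" in
  move=> a x y; rewrite ?(linearP, mulrDl, mulrDr, =^~ scalerAl, =^~ scalerAr);
  reflexivity.

Ltac solve_klin :=
  cbv beta;
  lazymatch goal with
  | |- forall _, _ => intro; solve_klin
  | |- _ => first [refine (linear_klin _); solve [solve_linear] | solve_klin_core]
  end
with solve_klin_core :=
  match goal with
  | |- klin _ (fun x => sweedler _ (fun u v => @?f x u v) ?h) =>
      apply: klin_swf => ? ?; solve [solve_klin]
  | |- klin _ (fun x => sweedler ?i ?f (@?g x)) =>
      refine (@klin_comp _ _ _ _ _ _ (sweedler i f) _ _ _); [solve [solve_linear] | exact: klin_sw]
  | |- klin _ (sweedler _ _) => exact: klin_sw
  | |- klin _ (mulmx ?A) => refine (klin_mulmxr A _); solve [solve_klin]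
  | |- klin _ (tensmx ?A) => refine (klin_tensr A _); solve [solve_klin]
  | |- klin _ (fun x => \sum_(i <- _ | _) _) => apply: klin_sum => ?; solve [solve_klin]
  | |- klin _ (fun x => ?c *: @?f x) => apply: klinZf; solve [solve_klin]
  | |- klin _ (fun x => ?A *m @?f x) => apply: klin_mulmxr; solve [solve_klin]
  | |- klin _ (fun x => @?f x *m ?A) => apply: klin_mulmxl; solve [solve_klin]
  | |- klin _ (fun x => ?A *t @?f x) => apply: klin_tensr; solve [solve_klin]
  | |- klin _ (fun x => @?f x *t ?A) => apply: klin_tensl; solve [solve_klin]
  | lf : ?P |- ?P => exact: lf
  | lf : klin _ ?f |- klin _ (fun x => ?f (@?g x)) =>
      refine (@klin_comp _ _ _ _ _ _ f g _ _); [solve [solve_linear] | exact: lf]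
  | lf : forall y, klin _ (fun x => ?f x y) |- klin _ (fun x => ?f (@?g x) ?z) =>
      refine (@klin_comp _ _ _ _ _ _ (fun x => f x z) g _ _); [solve [solve_linear] | exact: lf]
  | lf : forall y, klin _ (?f y) |- klin _ (fun x => ?f ?z (@?g x)) =>
      refine (@klin_comp _ _ _ _ _ _ (f z) g _ _); [solve [solve_linear] | exact: lf]
  | |- _ => by apply: klin_scalel => ? ? ?;
      rewrite !(linearP, mulrDl, mulrDr, =^~ scalerAl, =^~ scalerAr) ?mxE
  end.

(** * The antipode reverses products and coproducts *)

Section Antipode.
Variables (k : fieldType) (H : hopfAlgType k).
Implicit Types a b h : H.
Local Notation S := (@antipode k H).
Local Notation sw := (@sweedler k H k idfun H).

Lemma antipode1 : S 1 = 1.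
Proof.
have : sw (fun x y => S x * y) 1 = 1.
  rewrite (@sw_antil k H k idfun H (fun x => x)); last by solve_klin.
  by rewrite counit1 scale1r.
rewrite sw1; first by rewrite mulr1.
  by solve_klin.
by solve_klin.
Qed.

Lemma counit_antipode h : counit (S h) = counit h.
Proof.
have eps_lin : @klin k k idfun H (k^o : lmodType k) (@counit k H) by move=> a x y; rewrite linearP.
have := @sw_antil k H k idfun (k^o : lmodType k) (@counit k H) h eps_lin.
rewrite counit1.
under (@eq_sw k H k idfun (k^o : lmodType k)) => x y.
  rewrite counitM mulrC.
  over.
rewrite (@sw_counitr k H k idfun (k^o : lmodType k) (fun x => counit (S x))).
  by move=> ->; rewrite /= -[RHS]mulr1.
solve_klin.
Qed.

(** Both sides are convolution inverses of the multiplication on H (x) H. The term [G], S(a_1 b_1)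
    a_2 b_2 S(b_3) S(a_3) in Sweedler form, is contracted in two ways: its right part collapses to
    counits and leaves S(ab), its left part does so and leaves S(b) S(a). *)
Lemma antipodeM a b : S (a * b) = S b * S a.
Proof.
pose G (a1 b1 x u y v : H) : H := S (a1 * b1) * (x * u * (S v * S y)).
transitivity (sw (fun a1 a2 => sw (fun b1 b2 => sw (fun x y =>
  sw (fun u v => G a1 b1 x u y v) b2) a2) b) a).
  have GE a1 b1 a2 b2 : sw (fun x y => sw (fun u v => G a1 b1 x u y v) b2) a2
      = counit b2 *: (counit a2 *: S (a1 * b1)).
    transitivity (sw (fun x y => counit b2 *: (S (a1 * b1) * (x * S y))) a2).
      apply: eq_sw => x y.
      transitivity (sw (fun u v => S (a1 * b1) * (x * (u * S v) * S y)) b2).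
        by apply: eq_sw => u v; rewrite /G !mulrA.
      rewrite (sw_antir (fun z => S (a1 * b1) * (x * z * S y)) b2); last by solve_klin.
      by rewrite mulr1.
    rewrite -sw_scale; congr (_ *: _).
    rewrite (sw_antir (fun z => S (a1 * b1) * z) a2); last by solve_klin.
    by rewrite mulr1.
  under eq_sw => a1 a2 do under eq_sw => b1 b2 do rewrite GE.
  under eq_sw => a1 a2.
    rewrite (sw_counitr (fun z => counit a2 *: S (a1 * z)) b); last by solve_klin.
    over.
  by rewrite (sw_counitr (fun z => S (z * b)) a); last by solve_klin.
symmetry; transitivity (sw (fun a12 y => sw (fun b12 v =>
    sw (fun a1 x => sw (fun b1 u => G a1 b1 x u y v) b12) a12) b) a).
  have GE a12 y b12 v :
      sw (fun a1 x => sw (fun b1 u => G a1 b1 x u y v) b12) a12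
      = counit a12 *: (counit b12 *: (S v * S y)).
    transitivity (sw (fun p q => S p * q * (S v * S y)) (a12 * b12)).
      rewrite swM.
        by apply: eq_sw => a1 x; apply: eq_sw => b1 u; rewrite /G !mulrA.
        by solve_klin.
        by solve_klin.
    rewrite (sw_antil (fun z => z * (S v * S y))); last by solve_klin.
    by rewrite /= counitM scalerA mul1r.
  under eq_sw => a12 y do under eq_sw => b12 v do rewrite GE.
  under eq_sw => a12 y.
    rewrite -sw_scale (sw_counitl (fun v => S v * S y) b); last by solve_klin.
    over.
  by rewrite (sw_counitl (fun y => S b * S y) a); last by solve_klin.
under eq_sw => a12 y do rewrite sw_sw.
under eq_sw => a12 y do under eq_sw => a1 x do rewrite sw_coassoc.
rewrite sw_coassoc; apply: eq_sw => a1 a2.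
by rewrite sw_sw.
Qed.

End Antipode.

Section AntipodeComul.
Variables (k : fieldType) (H : hopfAlgType k).
Variables (L : fieldType) (iota : {rmorphism k -> L}).
Local Notation S := (@antipode k H).
Local Notation sw := (@sweedler k H L iota _).

(** Dual to [antipodeM]: the coproduct of S(a) and S(a_2) (x) S(a_1) are both convolution inverses
    of the coproduct. [G x y r] encodes the triple product with legs x, y, r of a; cancelling S(x) y
    gives the right-hand side, cancelling y against r gives the left-hand one. *)
Lemma sw_antipode (W : lmodType L) (f : H -> H -> W) a :
    (forall y, klin iota (f^~ y)) -> (forall x, klin iota (f x)) ->
  sw f (S a) = sw (fun x y => f (S y) (S x)) a.
Proof.
move=> fl fr.
pose g r c d := sw (fun r1 r2 => f (c * S r2) (d * S r1)) r.
pose G x y r := sw (fun p q => sw (fun y1 y2 => g r (p * y1) (q * y2)) y) (S x).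
have gl r d : klin iota (fun c => g r c d) by rewrite /g; solve_klin.
have gr r c : klin iota (g r c) by rewrite /g; solve_klin.
transitivity (sw (fun u r => sw (fun x y => G x y r) u) a); last first.
  transitivity (sw (fun u r => iota (counit u) *: g r 1 1) a).
    apply: eq_sw => u r; rewrite -(@sw1 k H L iota W (g r)) //.
    rewrite -(sw_antil (sw (g r)) u); last exact: klin_sw.
    by apply: eq_sw => x y; rewrite swM.
  rewrite (sw_counitl (fun r => g r 1 1)); last by rewrite /g; solve_klin.
  by apply: eq_sw => x y; rewrite !mul1r.
rewrite sw_coassoc.
(* The four legs of y' are y1, y2, r1, r2; the inner pair y2 S(r1) cancels first, then y1 S(r2). *)
have E p q y' : sw (fun y r => sw (fun y1 y2 => g r (p * y1) (q * y2)) y) y'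
    = iota (counit y') *: f p q.
  rewrite sw_coassoc /g.
  transitivity (sw (fun y1 z => sw (fun w r2 => sw (fun y2 r1 =>
      f (p * y1 * S r2) (q * (y2 * S r1))) w) z) y').
    apply: eq_sw => y1 z; rewrite sw_coassoc.
    by apply: eq_sw => y2 r; apply: eq_sw => r1 r2; rewrite mulrA.
  transitivity (sw (fun y1 z => f (p * (y1 * S z)) q) y').
    apply: eq_sw => y1 z.
    rewrite -[RHS](@sw_counitl k H L iota W (fun z => f (p * (y1 * S z)) q)) //; last by solve_klin.
    apply: eq_sw => w r2.
    rewrite (sw_antir (fun z => f (p * y1 * S r2) (q * z))); last by solve_klin.
    by rewrite mulr1 mulrA.
  rewrite (sw_antir (fun z => f (p * z) q)); last by solve_klin.
  by rewrite mulr1.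
transitivity (sw (fun x y => iota (counit y) *: sw f (S x)) a).
  by rewrite (sw_counitr (fun x => sw f (S x))) //; solve_klin.
apply: eq_sw => x y'; rewrite /G sw_sw sw_scale.
by apply: eq_sw => p q; rewrite E.
Qed.

End AntipodeComul.

Section LinearTensors.
Variables (k : fieldType) (H : hopfAlgType k).
Variables (L : fieldType) (iota : {rmorphism k -> L}).
Variable V : lmodType L.

Lemma linL_sw (W : lmodType L) (f : V -> H -> H -> W) h :
  (forall u v, linear (fun x => f x u v)) -> linear (fun x => sweedler iota (f x) h).
Proof.
move=> lf a x y; rewrite /sweedler /liftL scaler_sumr -big_split.
apply: eq_bigr => i _; rewrite scaler_sumr -big_split; apply: eq_bigr => j _ /=.
by rewrite lf scalerDr !scalerA mulrC.
Qed.

Lemma linL_sum (W : lmodType L) (I : Type) (r : seq I) (P : pred I) (f : I -> V -> W) :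
  (forall i, linear (f i)) -> linear (fun x => \sum_(i <- r | P i) f i x).
Proof. exact: (@klin_sum L L idfun). Qed.

Lemma linL_scale (W : lmodType L) c (f : V -> W) :
  linear f -> linear (fun x => c *: f x).
Proof. exact: (@klinZf L L idfun). Qed.

Lemma linL_mulmxl m p q (f : V -> 'M[L]_(m, p)) (B : 'M_(p, q)) :
  linear f -> linear (fun x => f x *m B).
Proof. exact: (@klin_mulmxl L L idfun). Qed.

Lemma linL_mulmxr m p q (A : 'M_(m, p)) (f : V -> 'M[L]_(p, q)) :
  linear f -> linear (fun x => A *m f x).
Proof. exact: (@klin_mulmxr L L idfun). Qed.

Lemma linL_tensl m n p q (f : V -> 'M[L]_(m, n)) (B : 'M_(p, q)) :
  linear f -> linear (fun x => f x *t B).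
Proof. exact: (@klin_tensl L L idfun). Qed.

Lemma linL_tensr m n p q (A : 'M_(m, n)) (f : V -> 'M[L]_(p, q)) :
  linear f -> linear (fun x => A *t f x).
Proof. exact: (@klin_tensr L L idfun). Qed.

End LinearTensors.

Ltac solve_linearL :=
  cbv beta;
  match goal with
  | |- forall _, _ => intro; solve [solve_linearL]
  | |- linear (fun x => x) => exact: linear_id
  | |- linear (mulmx ?A) => refine (linL_mulmxr A _); solve [solve_linearL]
  | |- linear (tensmx ?A) => refine (linL_tensr A _); solve [solve_linearL]
  | |- linear (fun x => sweedler _ _ _) => apply: linL_sw => ? ?; solve [solve_linearL]
  | |- linear (fun x => bigop.body _ _ _) => apply: linL_sum => ?; solve [solve_linearL]
  | |- _ => apply: linL_scale; solve [solve_linearL]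
  | |- _ => apply: linL_mulmxr; solve [solve_linearL]
  | |- _ => apply: linL_mulmxl; solve [solve_linearL]
  | |- _ => apply: linL_tensr; solve [solve_linearL]
  | |- _ => apply: linL_tensl; solve [solve_linearL]
  end.

(** * Modules, comodules and their operators as matrices *)

Section Coordinates.
Variables (k : fieldType) (H : hopfAlgType k).
Variables (L : fieldType) (iota : {rmorphism k -> L}).
Local Notation n := (\dim {:H}).
Local Notation e i := (vbasis {:H})`_i.
Local Notation S := (@antipode k H).
Local Notation sw := (@sweedler k H L iota _).
Local Notation cof i h := (iota (coord (vbasis {:H}) i h)).

Definition colv (h : H) : 'cV[L]_n := \col_q cof q h.

Lemma colv_klin : klin iota colv.
Proof. by move=> a x y; apply/colP=> q; rewrite !mxE linearP rmorphD rmorphM. Qed.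

Definition mxlin m (g : H -> 'cV[L]_m) : 'M[L]_(m, n) :=
  \matrix_(p, q) g (e q) p 0.

Lemma mxlinE m (g : H -> 'cV[L]_m) h : klin iota g -> mxlin g *m colv h = g h.
Proof.
move=> lg; rewrite [RHS](klin_basis _ lg); apply/colP=> p.
rewrite !mxE summxE; apply: eq_bigr => q _.
by rewrite !mxE mulrC.
Qed.

Lemma col_basis (q : 'I_n) : colv (e q) = delta_mx q 0.
Proof.
by apply/colP=> p; rewrite !mxE eqxx andbT coord_vbasis_elt rmorph_nat.
Qed.

(** The matrix [colv h *t 1%:M] is the map m |-> h (x) m, so operators on H (x) M can be compared on
    h (x) m without ever naming the vector m. *)
Lemma eq_mul_tens w r (G G' : 'M[L]_(r, n * w)) :
  (forall h, G *m (colv h *t 1%:M) = G' *m (colv h *t (1%:M : 'M_w))) -> G = G'.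
Proof.
move=> E; rewrite -[G]mulmx1 -[G']mulmx1 -tensmx11.
have -> : (1%:M : 'M[L]_n) = \sum_(q < n) colv (e q) *m delta_mx 0 q :> 'M_n.
  under eq_bigr => q _ do rewrite col_basis mul_delta_mx.
  apply/matrixP=> i j; rewrite summxE mxE (bigD1 i) //= big1 => [|q nq].
    by rewrite mxE eqxx addr0 eq_sym.
  by rewrite mxE eq_sym (negPf nq).
rewrite tensmx_suml !mulmx_sumr; apply: eq_bigr => q _.
have -> : (colv (e q) *m delta_mx 0 q) *t (1%:M : 'M[L]_w) =
    (colv (e q) *t 1%:M) *m (delta_mx 0 q *t 1%:M) by rewrite tensmx_mul mulmx1.
by rewrite !mulmxA E.
Qed.

Lemma eq_mul_colv r (G G' : 'M[L]_(r, n)) :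
  (forall h, G *m colv h = G' *m colv h) -> G = G'.
Proof.
move=> E; apply/matrixP=> i j; have := congr1 (fun A : 'M_(_, 1) => A i 0) (E (e j)).
by rewrite col_basis -!colE !mxE.
Qed.

Lemma op_tens (I : finType) m w r (g : I -> H -> 'cV[L]_m) (X : I -> 'M[L]_w)
    h (B : 'M_(w, r)) : (forall i, klin iota (g i)) ->
  (\sum_i mxlin (g i) *t X i) *m (colv h *t B) = \sum_i g i h *t (X i *m B).
Proof.
move=> lg; rewrite mulmx_suml; apply: eq_bigr => i _.
by rewrite tensmx_mul mxlinE.
Qed.

Definition is_rep w (R : H -> 'M[L]_w) :=
  [/\ klin iota R, R 1 = 1%:M & forall x y, R (x * y) = R x *m R y].

(* The coaction is m |-> sum_i C_i m (x) e_i, i.e. e_i^* |-> C_i represents the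
   dual algebra. *)
Definition is_corep w (C : 'I_n -> 'M[L]_w) :=
  (forall i j, C i *m C j =
     \sum_(l < n) iota ((coprod (e l) : 'M[k]_(_, _)) i j) *: C l)
  /\ \sum_(i < n) iota (counit (e i)) *: C i = 1%:M.

(** Coassociativity of the coaction, in the form in which it is used: m_0 (x) (m_1)_1 (x) (m_1)_2 is
    C_i C_j m (x) e_i (x) e_j summed over i and j, tested against [G]. *)
Lemma corep_sum w (C : 'I_n -> 'M[L]_w) (W : lmodType L)
    (G : H -> H -> 'M_w -> W) : is_corep C -> (forall x y, linear (G x y)) ->
  \sum_(l < n) sw (fun x y => G x y (C l)) (e l) =
  \sum_(i < n) \sum_(j < n) G (e i) (e j) (C i *m C j).
Proof.
move=> [CC _] lG; rewrite exchange_big; apply: eq_bigr => i _.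
rewrite exchange_big; apply: eq_bigr => j _; rewrite CC.
pose b := GRing.isLinear.Build _ _ _ _ _ (lG (e i) (e j)).
pose F : {linear 'M_w -> W} := HB.pack (G (e i) (e j)) b.
by rewrite -[G _ _]/(F : _ -> _) linear_sum; apply: eq_bigr => l _; rewrite linearZ.
Qed.

Lemma corep_unit w (C : 'I_n -> 'M[L]_w) (W : lmodType L)
    (G : 'M_w -> W) : is_corep C -> linear G ->
  \sum_(l < n) iota (counit (e l)) *: G (C l) = G 1%:M.
Proof.
move=> [_ <-] lG.
pose b := GRing.isLinear.Build _ _ _ _ _ lG.
pose F : {linear 'M_w -> W} := HB.pack G b.
by rewrite -[G]/(F : _ -> _) linear_sum; apply: eq_bigr => l _; rewrite linearZ.
Qed.

Arguments corep_sum {w C W} G _ _.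
Arguments corep_unit {w C W} G _ _.

(* Operators on H (x) M, for a right comodule C or a left module R on M:
   coact_mull: h (x) m |-> m_1 h (x) m_0     coact_mulr: h (x) m |-> h m_1 (x) m_0
   comul_actr: h (x) m |-> h_1 (x) h_2 m     comul_actl: h (x) m |-> h_2 (x) h_1 m *)
Definition coact_mull w (C : 'I_n -> 'M[L]_w) : 'M[L]_(n * w) :=
  \sum_(j < n) mxlin (fun h => colv (e j * h)) *t C j.

Definition comul_actr w (R : H -> 'M[L]_w) : 'M[L]_(n * w) :=
  \sum_(i < n) mxlin (sw (fun x y => cof i y *: colv x)) *t R (e i).

Definition coact_mulr w (C : 'I_n -> 'M[L]_w) : 'M[L]_(n * w) :=
  \sum_(j < n) mxlin (fun h => colv (h * e j)) *t C j.

Definition comul_actl w (R : H -> 'M[L]_w) : 'M[L]_(n * w) :=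
  \sum_(i < n) mxlin (sw (fun x y => cof i x *: colv y)) *t R (e i).

Let lcol := colv_klin.

Lemma coact_mull_tens w C r h (B : 'M_(w, r)) :
  coact_mull C *m (colv h *t B) = \sum_(j < n) colv (e j * h) *t (C j *m B).
Proof. by rewrite op_tens // => i; solve_klin. Qed.

Lemma coact_mulr_tens w C r h (B : 'M_(w, r)) :
  coact_mulr C *m (colv h *t B) = \sum_(j < n) colv (h * e j) *t (C j *m B).
Proof. by rewrite op_tens // => i; solve_klin. Qed.

Lemma comul_actr_tens w R r h (B : 'M_(w, r)) : klin iota R ->
  comul_actr R *m (colv h *t B) = sw (fun x y => colv x *t (R y *m B)) h.
Proof.
move=> lR; rewrite op_tens => [|i]; last exact: klin_sw.
under eq_bigr => i _ do rewrite sw_tensl.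
rewrite sw_sum; apply: eq_sw => x y.
rewrite (klin_basis y lR) mulmx_suml tensmx_sumr; apply: eq_bigr => i _.
by rewrite tensmxZl -scalemxAl tensmxZr.
Qed.

Lemma comul_actl_tens w R r h (B : 'M_(w, r)) : klin iota R ->
  comul_actl R *m (colv h *t B) = sw (fun x y => colv y *t (R x *m B)) h.
Proof.
move=> lR; rewrite op_tens => [|i]; last exact: klin_sw.
under eq_bigr => i _ do rewrite sw_tensl.
rewrite sw_sum; apply: eq_sw => x y.
rewrite (klin_basis x lR) mulmx_suml tensmx_sumr; apply: eq_bigr => i _.
by rewrite tensmxZl -scalemxAl tensmxZr.
Qed.

(** The inverse is h (x) m |-> S(m_1) h (x) m_0. Nonvanishing suffices to cancel this determinant in
    [det_canonical], from which its exact order is drawn afterwards. *)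
Lemma coact_mull_unit w (C : 'I_n -> 'M[L]_w) : is_corep C -> \det (coact_mull C) != 0.
Proof.
move=> cC.
pose Y' := \sum_(j < n) mxlin (fun h => colv (S (e j) * h)) *t C j.
suff YY : coact_mull C *m Y' = 1%:M.
  apply/eqP => d0; have /eqP := congr1 (fun A : 'M_(_) => \det A) YY.
  by rewrite det_mulmx d0 mul0r det1 eq_sym oner_eq0.
apply: eq_mul_tens => h; rewrite -mulmxA mul1mx op_tens => [|j]; last by solve_klin.
rewrite mulmx_sumr; under eq_bigr => j _ do rewrite coact_mull_tens.
rewrite exchange_big /=.
transitivity (\sum_(l < n) sw (fun x y => colv (x * (S y * h)) *t (C l *m 1%:M)) (e l)).
  rewrite (corep_sum (fun x y M => colv (x * (S y * h)) *t (M *m 1%:M)) cC); last by solve_linearL.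
  by apply: eq_bigr => i _; apply: eq_bigr => j _; rewrite mulmxA.
transitivity (\sum_(l < n) iota (counit (e l)) *: (colv h *t (C l *m 1%:M))).
  apply: eq_bigr => l _.
  rewrite -[in RHS](mul1r h) -(sw_antir (fun z => colv (z * h) *t (C l *m 1%:M))); last by solve_klin.
  by apply: eq_sw => x y; rewrite mulrA.
rewrite (corep_unit (fun M => colv h *t (M *m 1%:M)) cC); last by solve_linearL.
by rewrite mulmx1.
Qed.

(** The inverse is h (x) m |-> h_1 (x) S(h_2) m. *)
Lemma comul_actr_unit w (R : H -> 'M[L]_w) : is_rep R -> \det (comul_actr R) != 0.
Proof.
move=> [lR R1 RM].
pose J' := comul_actr (fun h => R (S h)).
have lR' : klin iota (fun h => R (S h)) by solve_klin.
suff YY : comul_actr R *m J' = 1%:M.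
  apply/eqP => d0; have /eqP := congr1 (fun A : 'M_(_) => \det A) YY.
  by rewrite det_mulmx d0 mul0r det1 eq_sym oner_eq0.
apply: eq_mul_tens => h; rewrite -mulmxA mul1mx comul_actr_tens // sw_mulmxl.
under eq_sw => x y do rewrite comul_actr_tens //.
rewrite sw_coassoc.
transitivity (sw (fun x y => iota (counit y) *: (colv x *t (1%:M : 'M_w))) h).
  apply: eq_sw => x y; rewrite -[in RHS]R1 -(mulmx1 (R 1)).
  rewrite -(sw_antir (fun z => colv x *t (R z *m 1%:M)) y); last by solve_klin.
  by apply: eq_sw => u v; rewrite RM mulmxA.
by rewrite (sw_counitr (fun x => colv x *t 1%:M)) //; solve_klin.
Qed.

(* Tensoring with the regular representation: the canonical operator X of H and its
   dual satisfies J Y = Y (1 (x) X) J on H (x) M with J, Y invertible. *)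
Lemma det_canonical w (R : H -> 'M[L]_w) (C : 'I_n -> 'M[L]_w) :
    is_rep R -> is_corep C -> (forall h i, R h *m C i = C i *m R h) ->
  \det (\sum_(l < n) R (e l) *m C l) ^+ n = 1.
Proof.
move=> rR cC RC; set X := \sum_(l < n) _; case: (rR) => lR R1 RM.
have E : comul_actr R *m coact_mull C = coact_mull C *m ((1%:M : 'M_n) *t X) *m comul_actr R.
  apply: eq_mul_tens => h; rewrite -!mulmxA coact_mull_tens comul_actr_tens // !sw_mulmxl mulmx_sumr.
  transitivity (\sum_(l < n) sw (fun x y => sw (fun u v =>
     colv (x * u) *t (R (y * v) *m (C l *m 1%:M))) h) (e l)).
    by apply: eq_bigr => l _; rewrite comul_actr_tens // swM //; solve_klin.
  rewrite (corep_sum (fun x y M => sw (fun u v =>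
     colv (x * u) *t (R (y * v) *m (M *m 1%:M))) h) cC); last by solve_linearL.
  under eq_bigr => i _ do rewrite sw_sum.
  rewrite sw_sum; apply: eq_sw => u v; rewrite tensmx_mul mul1mx coact_mull_tens.
  apply: eq_bigr => i _; rewrite -tensmx_sumr mulmx_suml mulmx_sumr.
  congr (_ *t _); apply: eq_bigr => j _.
  by rewrite RM !mulmx1 -!mulmxA [R v *m _]mulmxA RC -mulmxA RC !mulmxA RC.
have := congr1 (fun A : 'M_(_) => \det A) E; rewrite !det_mulmx det_tens1mx.
move/eqP; rewrite mulrC -subr_eq0 -mulrBl mulf_eq0 (negPf (comul_actr_unit rR)) orbF.
rewrite -{1}[\det (coact_mull C)]mulr1 -mulrBr mulf_eq0 (negPf (coact_mull_unit cC)) /=.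
by rewrite subr_eq0 eq_sym => /eqP.
Qed.

End Coordinates.
Arguments corep_sum {k H L iota w C W} G _ _.
Arguments corep_unit {k H L iota w C W} G _ _.

(** * The regular module and the regular comodule *)

Section Regular.
Variables (k : fieldType) (H : hopfAlgType k).
Variables (L : fieldType) (iota : {rmorphism k -> L}).
Local Notation n := (\dim {:H}).
Local Notation e i := (vbasis {:H})`_i.
Local Notation sw := (@sweedler k H L iota _).
Local Notation colv := (@colv k H L iota).
Local Notation cof i h := (iota (coord (vbasis {:H}) i h)).
Let lcol : klin iota colv := @colv_klin k H L iota.

Definition mx2 m (g : H -> H -> 'cV[L]_m) : 'M[L]_(m, n * n) :=
  \matrix_(p, q) g (e (mxtens_unindex q).1) (e (mxtens_unindex q).2) p 0.

Lemma cofK (W : lmodType L) (f : H -> W) h : klin iota f ->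
  \sum_(i < n) cof i h *: f (e i) = f h.
Proof. by move=> lf; rewrite -klin_basis. Qed.

Lemma sw_coord (W : lmodType L) (i j : 'I_n) (B : W) h :
  sw (fun x y => cof i x *: (cof j y *: B)) h =
  iota ((coprod h : 'M[k]_(_, _)) i j) *: B.
Proof.
rewrite /sweedler /liftL (bigD1 i) //= (bigD1 j) //= !coord_vbasis_elt !eqxx !rmorph1 !scale1r.
rewrite !big1 ?addr0 // => [p np|q nq].
  rewrite big1 // => q _.
  by rewrite !coord_vbasis_elt [i == _]eq_sym (negPf np) rmorph0 !scale0r scaler0.
by rewrite !coord_vbasis_elt [j == _]eq_sym (negPf nq) rmorph0 !(scale0r, scaler0).
Qed.

Definition regC (i : 'I_n) : 'M[L]_n := mxlin (sw (fun x y => cof i y *: colv x)).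

Lemma regC_col i h : regC i *m colv h = sw (fun x y => cof i y *: colv x) h.
Proof. by rewrite mxlinE //; apply: klin_sw. Qed.

Lemma regC_corep : is_corep iota regC.
Proof.
split=> [i j|].
  apply: (@eq_mul_colv k H L iota) => h; rewrite -mulmxA regC_col sw_mulmxl.
  transitivity (sw (fun x y => sw (fun a b => cof i b *: (cof j y *: colv a)) x) h).
    apply: eq_sw => x y; rewrite -scalemxAr regC_col sw_scale.
    by apply: eq_sw => a b; rewrite scalerA mulrC -scalerA.
  rewrite sw_coassoc mulmx_suml.
  transitivity (sw (fun x y => iota ((coprod y : 'M[k]_(_, _)) i j) *: colv x) h).
    by apply: eq_sw => x y; rewrite sw_coord.
  have E x y : iota ((coprod y : 'M[k]_(_, _)) i j) *: colv x =
    \sum_(l < n) iota ((coprod (e l) : 'M[k]_(_, _)) i j) *: (cof l y *: colv x).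
    under eq_bigr => l _ do rewrite scalerA mulrC -scalerA.
    rewrite (@cofK _ (fun y => iota ((coprod y : 'M[k]_(_, _)) i j) *: colv x)) //.
    by apply: klin_scalel => a u v; rewrite linearP !mxE.
  under eq_sw => x y do rewrite E.
  rewrite -sw_sum; apply: eq_bigr => l _.
  by rewrite -scalemxAl regC_col sw_scale.
apply: (@eq_mul_colv k H L iota) => h; rewrite mul1mx mulmx_suml.
under eq_bigr => i _ do rewrite -scalemxAl regC_col sw_scale.
rewrite sw_sum -[RHS](@sw_counitr k H L iota _ colv) //; apply: eq_sw => x y.
under eq_bigr => i _ do rewrite scalerA mulrC -scalerA.
rewrite (@cofK _ (fun y => iota (counit y) *: colv x)) //.
by apply: klin_scalel => a u v; rewrite linearP.
Qed.

Definition regR (a : H) : 'M[L]_n := mxlin (fun h => colv (a * h)).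

Lemma regR_col a h : regR a *m colv h = colv (a * h).
Proof. by rewrite mxlinE //; solve_klin. Qed.

Lemma regR_rep : is_rep iota regR.
Proof.
split=> [a x y||x y]; apply: (@eq_mul_colv k H L iota) => h.
- by rewrite mulmxDl -scalemxAl !regR_col mulrDl -scalerAl lcol.
- by rewrite regR_col mul1r mul1mx.
by rewrite -mulmxA !regR_col mulrA.
Qed.

Lemma eq_mul_tens2 w r (G G' : 'M[L]_(r, n * (n * w))) :
  (forall h b, G *m (colv h *t (colv b *t 1%:M)) =
               G' *m (colv h *t (colv b *t (1%:M : 'M_w)))) -> G = G'.
Proof.
move=> E; apply: (@eq_mul_tens k H L iota) => h; rewrite -tensmx11.
have -> : (1%:M : 'M[L]_n) = \sum_(q < n) colv (e q) *m delta_mx 0 q :> 'M_n.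
  apply: (@eq_mul_colv k H L iota) => b; rewrite mul1mx mulmx_suml {1}[b](coord_vbasis (memvf b)).
  rewrite (klin_sumE _ _ _ lcol); apply: eq_bigr => q _.
  rewrite (klinZ lcol) -mulmxA.
  have -> : delta_mx 0 q *m colv b = (cof q b)%:M :> 'M_1.
    by rewrite -rowE; apply/matrixP=> i j; rewrite !ord1 !mxE eqxx.
  by rewrite mul_mx_scalar.
rewrite tensmx_suml tensmx_sumr !mulmx_sumr; apply: eq_bigr => q _.
have -> : colv h *t ((colv (e q) *m delta_mx 0 q) *t (1%:M : 'M[L]_w)) =
    (colv h *t (colv (e q) *t 1%:M)) *m (1%:M *t (delta_mx 0 q *t 1%:M)).
  by rewrite !tensmx_mul !mulmx1.
by rewrite !mulmxA E.
Qed.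

Lemma mx2E m (g : H -> H -> 'cV[L]_m) x y :
    (forall y, klin iota (g^~ y)) -> (forall x, klin iota (g x)) ->
  mx2 g *m (colv x *t colv y) = g x y.
Proof.
move=> gl gr; apply/colP=> p; rewrite [LHS]mxE.
rewrite [g x y](klin_basis x (gl y)) summxE.
under [RHS]eq_bigr => i _ do rewrite mxE (klin_basis y (gr (e i))) summxE mulr_sumr.
rewrite pair_big (reindex (@mxtens_index n n)) /=; last first.
  exists (@mxtens_unindex n n) => ? _; [exact: mxtens_indexK|exact: mxtens_unindexK].
apply: eq_bigr => -[i j] _; rewrite !mxE !mxtens_indexK /=.
by rewrite mulrC mulrA.
Qed.

End Regular.

(** * Bijectivity of the antipode in finite dimension *)

Section AntipodeBijective.
Variables (k : fieldType) (H : hopfAlgType k).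
Variables (L : fieldType) (iota : {rmorphism k -> L}).
Local Notation n := (\dim {:H}).
Local Notation e i := (vbasis {:H})`_i.
Local Notation sw := (@sweedler k H L iota _).
Local Notation colv := (@colv k H L iota).
Local Notation regC := (@regC k H L iota).
Local Notation cof i h := (iota (coord (vbasis {:H}) i h)).
Let lcol : klin iota colv := @colv_klin k H L iota.

Lemma coact_mulr_reg_unit : coact_mulr iota regC \in unitmx.
Proof.
(* With t acting on H^3, A_23 t_12 t_13 = t_12 A_23 and A is invertible; as t_12
   and t_13 have the same rank, t_13 factors through t_12 A_23. All of A_23, t_13
   fix the vectors v (x) 1, on which t_12 is t, so t is injective. *)
pose t := coact_mulr iota regC.
pose Z := mxlin (fun b => colv b *t colv 1) : 'M[L]_(n * n, n).
have ZE b : Z *m colv b = colv b *t colv 1.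
  by rewrite mxlinE //; exact: (klin_tensl (colv 1) lcol).
(* [Emb] is h (x) b |-> h (x) b (x) 1. Below, [A], [Y] and [X] are A_23, t_12 and t_13, and [P]
   flips the last two factors. *)
pose Emb : 'M[L]_(n * (n * n), n * n) := 1%:M *t Z.
pose A := (1%:M : 'M[L]_n) *t coact_mull iota regC.
pose Y := coact_mulr iota (fun i => regC i *t (1%:M : 'M_n)).
pose X := coact_mulr iota (fun i => (1%:M : 'M_n) *t regC i).
pose P := (1%:M : 'M[L]_n) *t tens_swap L n n.
have PP : P *m P = 1%:M by rewrite tensmx_mul mul1mx tens_swapK tensmx11.
have Pu : P \in unitmx by case/mulmx1_unit: PP.
have YP : Y *m P = P *m X.
  rewrite mulmx_suml mulmx_sumr; apply: eq_bigr => j _.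
  by rewrite !tensmx_mul mul1mx mulmx1 tens_swapE.
have Au : A \in unitmx.
  rewrite unitmxE det_tens1mx unitrX // unitfE.
  exact/coact_mull_unit/regC_corep.
(* Both sides send h (x) b (x) c to h c_3 b_2 (x) c_2 b_1 (x) c_1, by multiplicativity of the
   coproduct. *)
have pent : A *m Y *m X = Y *m A.
  apply: (@eq_mul_tens2 k H L iota) => h b; rewrite -!mulmxA.
  transitivity (\sum_(j < n) sw (fun x y => \sum_(l < n) colv (h * (e j * y)) *t
     (colv (e l * x) *t (regC l *m (regC j *m 1%:M)))) b).
    rewrite coact_mulr_tens mulmx_sumr mulmx_sumr; apply: eq_bigr => j _.
    rewrite tensmx_mul mul1mx coact_mulr_tens mulmx_sumr.
    transitivity (\sum_(i < n) sw (fun x y => \sum_(l < n) (cof i y *: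
      (colv (h * (e j * e i)) *t (colv (e l * x) *t (regC l *m (regC j *m 1%:M)))))) b).
      apply: eq_bigr => i _; rewrite !tensmx_mul mul1mx mul1mx regC_col.
      rewrite sw_tensl sw_mulmxl sw_tensr; apply: eq_sw => x y.
      rewrite tensmxZl -scalemxAr coact_mull_tens tensmxZr tensmx_sumr scaler_sumr mulrA.
      by [].
    rewrite sw_sum; apply: eq_sw => x y; rewrite exchange_big; apply: eq_bigr => l _ /=.
    by rewrite (@cofK k H L iota _ (fun y => colv (h * (e j * y)) *t
      (colv (e l * x) *t (regC l *m (regC j *m 1%:M))))) //; solve_klin.
  rewrite tensmx_mul mul1mx coact_mull_tens tensmx_sumr mulmx_sumr.
  transitivity (\sum_(l < n) sw (fun p q => sw (fun x y => colv (h * (q * y)) *t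
      (colv (p * x) *t (regC l *m 1%:M))) b) (e l)).
    rewrite (corep_sum (fun p q M => sw (fun x y => colv (h * (q * y)) *t
      (colv (p * x) *t (M *m 1%:M))) b) (regC_corep H iota)); last by solve_linearL.
    rewrite [RHS]exchange_big; apply: eq_bigr => j _; rewrite sw_sum.
    by apply: eq_sw => x y; apply: eq_bigr => l _; rewrite mulmxA.
  apply: eq_bigr => l _; rewrite coact_mulr_tens.
  transitivity (\sum_(j < n) sw (fun x y => cof j y *: (colv (h * e j) *t
    (colv x *t (regC l *m 1%:M)))) (e l * b)).
    rewrite sw_sum -(swM (fun x y => colv (h * y) *t (colv x *t (regC l *m 1%:M)))).
    - apply: eq_sw => x y.
      by rewrite (@cofK k H L iota _ (fun y =>
        colv (h * y) *t (colv x *t (regC l *m 1%:M)))) //; solve_klin.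
    - by solve_klin.
    - by solve_klin.
  apply: eq_bigr => j _; rewrite tensmx_mul mul1mx regC_col sw_tensl sw_tensr.
  by apply: eq_sw => x y; rewrite tensmxZl tensmxZr.
have D1 j : regC j *m colv 1 = cof j 1 *: colv 1.
  by rewrite regC_col (@sw1 k H L iota) //; solve_klin.
have tZ (B C : 'M[L]_n) b : (B *t C) *m (Z *m colv b) =
    (B *m colv b) *t (C *m colv 1) :> 'cV_(n * n).
  by rewrite ZE; exact: (@tensmx_mul _ n n n n 1 1 B C (colv b) (colv 1)).
have DZ j : (1%:M *t regC j) *m Z = cof j 1 *: Z.
  apply: (@eq_mul_colv k H L iota) => b; rewrite -mulmxA -scalemxAl tZ.
  by rewrite mul1mx D1 tensmxZr ZE.
have XE : X *m Emb = Emb.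
  apply: (@eq_mul_tens k H L iota) => h; rewrite -mulmxA tensmx_mul mul1mx mulmx1.
  rewrite coact_mulr_tens; under eq_bigr => j _ do rewrite DZ tensmxZr.
  by rewrite (@cofK k H L iota _ (fun y => colv (h * y) *t Z)) ?mulr1 //; solve_klin.
have AE : A *m Emb = Emb.
  rewrite tensmx_mul mulmx1; congr (_ *t _).
  apply: (@eq_mul_colv k H L iota) => b; rewrite -mulmxA ZE.
  rewrite (@coact_mull_tens k H L iota n regC 1 b (colv 1)).
  under eq_bigr => j _ do rewrite D1 tensmxZr.
  rewrite (@cofK k H L iota _ (fun y => colv (y * b) *t colv 1)) ?mul1r //.
  by apply: klin_tensl; solve_klin.
have YE : Y *m Emb = Emb *m t.
  rewrite mulmx_suml mulmx_sumr; apply: eq_bigr => j _.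
  rewrite !tensmx_mul mulmx1 mul1mx; congr (_ *t _).
  apply: (@eq_mul_colv k H L iota) => b; rewrite -!mulmxA tZ regC_col sw_mulmxl.
  rewrite mul1mx sw_tensl; apply: eq_sw => x y.
  by rewrite tensmxZl -scalemxAr ZE.
pose Z' := mx2 (fun b m : H => iota (counit m) *: colv b).
have ZZ : Z' *m Z = 1%:M.
  apply: (@eq_mul_colv k H L iota) => b; rewrite -mulmxA ZE mx2E; last 2 first.
  - by move=> y; solve_klin.
  - by move=> x; apply: klin_scalel => a u v; rewrite linearP.
  by rewrite counit1 rmorph1 scale1r mul1mx.
have subYX : (Y *m A <= X)%MS by rewrite -pent submxMl.
have rk : \rank (Y *m A) = \rank X.
  rewrite mxrankMfree ?row_free_unit //.
  rewrite -(mxrankMfree Y (_ : row_free P)) ?row_free_unit // YP.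
  by rewrite eqmxMfull ?row_full_unit.
have /submxP[Q QX] : (X <= Y *m A)%MS.
  by rewrite -(mxrank_leqif_sup subYX) rk.
(* With X = Q Y A, one has Q Emb t = Q Y Emb = Q Y A Emb = X Emb = Emb, and [1%:M *t Z'] is a left
   inverse of [Emb]. *)
suff : ((1%:M : 'M_n) *t Z' *m Q *m Emb) *m t = 1%:M by case/mulmx1_unit.
rewrite -!mulmxA -YE -AE [Y *m _]mulmxA [Q *m _]mulmxA -QX XE.
by rewrite tensmx_mul mul1mx ZZ tensmx11.
Qed.

End AntipodeBijective.

Section AntipodeInverse.
Variables (k : fieldType) (H : hopfAlgType k).
Variables (L : fieldType) (iota : {rmorphism k -> L}).
Local Notation n := (\dim {:H}).
Local Notation e i := (vbasis {:H})`_i.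
Local Notation S := (@antipode k H).
Local Notation sw := (@sweedler k H L iota _).
Local Notation colv := (@colv k H L iota).
Local Notation regC := (@regC k H L iota).
Local Notation cof i h := (iota (coord (vbasis {:H}) i h)).
Let lcol : klin iota colv := @colv_klin k H L iota.

Lemma eq_mul_tens_col r (G G' : 'M[L]_(r, n * n)) :
  (forall x y, G *m (colv x *t colv y) = G' *m (colv x *t colv y)) -> G = G'.
Proof.
move=> E; apply/matrixP=> i j; case: (mxtens_indexP j) => p q.
have D : colv (e p) *t colv (e q) = delta_mx (mxtens_index (p, q)) 0 :> 'cV_(n * n).
  apply/colP=> l; case: (mxtens_indexP l) => u v.
  rewrite !col_basis !mxE !mxtens_indexK (can_eq (@mxtens_indexK _ _)) xpair_eqE /=.
  by rewrite !ord1 !eqxx !andbT -natrM mulnb.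
have := congr1 (fun A : 'M_(r, 1) => A i 0) (E (e p) (e q)).
by rewrite D -!colE !mxE.
Qed.

(* Applying x (x) y |-> y S(x) to t(h (x) m) = h m_2 (x) m_1 gives eps(m) S(h), so S
   is onto because t is. *)
Lemma mxlin_antipode_unit : mxlin (fun h => colv (S h)) \in unitmx.
Proof.
pose K := mx2 (fun x y => colv (y * S x)).
pose E := mx2 (fun h m : H => iota (counit m) *: colv h).
pose U := mxlin (fun z => colv 1 *t colv z) : 'M[L]_(n * n, n).
have KE x y : K *m (colv x *t colv y) = colv (y * S x) by rewrite (@mx2E k H L iota) //; solve_klin.
have EE x y : E *m (colv x *t colv y) = iota (counit y) *: colv x.
  by rewrite (@mx2E k H L iota) //; solve_klin.
have KU : K *m U = 1%:M.
  apply: (@eq_mul_colv k H L iota) => h; rewrite -mulmxA mxlinE; last first.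
    exact: (klin_tensr (colv 1) lcol).
  by rewrite KE antipode1 mulr1 mul1mx.
have KT : K *m coact_mulr iota regC = mxlin (fun h => colv (S h)) *m E.
  apply: eq_mul_tens_col => h m; rewrite -!mulmxA EE -scalemxAr mxlinE; last by solve_klin.
  rewrite (@coact_mulr_tens k H L iota n regC 1 h (colv m)) mulmx_sumr.
  transitivity (sw (fun x y => colv (x * S y * S h)) m).
    transitivity (\sum_(j < n) sw (fun x y => cof j y *: colv (x * S (h * e j))) m).
      apply: eq_bigr => j _; rewrite regC_col sw_tensr sw_mulmxl.
      by apply: eq_sw => x y; rewrite tensmxZr -scalemxAr KE.
    rewrite sw_sum; apply: eq_sw => x y.
    rewrite (@cofK k H L iota _ (fun z => colv (x * S (h * z)))); last by solve_klin.
    by rewrite antipodeM mulrA.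
  by rewrite (sw_antir (fun z => colv (z * S h))) ?mul1r //; solve_klin.
have := congr1 (mulmx^~ (invmx (coact_mulr iota regC) *m U)) KT.
rewrite -[K *m _ *m _]mulmxA mulKVmx ?coact_mulr_reg_unit // KU -mulmxA.
by move/esym/mulmx1_unit => [].
Qed.

End AntipodeInverse.

Lemma antipode_bij (k : fieldType) (H : hopfAlgType k) :
  exists Sb : 'End(H), cancel Sb antipode /\ cancel antipode Sb.
Proof.
have inj : lker (@antipode k H) == 0%VS.
  apply/eqP/vspaceP => h; rewrite memv_ker memv0; apply/eqP/eqP; last first.
    by move->; rewrite linear0.
  move=> Sh; have lS : klin idfun (fun h : H => colv idfun (antipode h)).
    by apply: klin_comp; [exact: linearP|exact: colv_klin].
  have U := mxlin_antipode_unit H (idfun : {rmorphism k -> k}).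
  have := mxlinE h lS; rewrite Sh (klin0 (colv_klin idfun)).
  move=> E; have := mulKmx U (colv idfun h); rewrite E mulmx0 => /esym h0.
  rewrite (coord_vbasis (memvf h)) big1 // => i _.
  by have := congr1 (fun A : 'cV_ _ => A i 0) h0; rewrite !mxE /= => ->; rewrite scale0r.
exists (antipode^-1)%VF; split; [exact: lker0_lfunVK|exact: lker0_lfunK].
Qed.

(** * Determinants of T, P, Y and J; anti-Yetter-Drinfeld modules *)

Section AntiYetterDrinfeld.
Variables (k : fieldType) (H : hopfAlgType k).
Variables (L : fieldType) (iota : {rmorphism k -> L}).
Local Notation n := (\dim {:H}).
Local Notation e i := (vbasis {:H})`_i.
Local Notation S := (@antipode k H).
Local Notation sw := (@sweedler k H L iota _).
Local Notation colv := (@colv k H L iota).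
Let lcol : klin iota colv := @colv_klin k H L iota.

Lemma rep_tens1 w m (R : H -> 'M[L]_w) :
  is_rep iota R -> is_rep iota (fun h => R h *t (1%:M : 'M_m)).
Proof.
case=> lR R1 RM; split; [by solve_klin | by rewrite R1 tensmx11 | move=> x y].
by rewrite tensmx_mul mul1mx RM.
Qed.

Lemma tens1_rep w m (R : H -> 'M[L]_w) :
  is_rep iota R -> is_rep iota (fun h => (1%:M : 'M_m) *t R h).
Proof.
case=> lR R1 RM; split; [by solve_klin | by rewrite R1 tensmx11 | move=> x y].
by rewrite tensmx_mul mul1mx RM.
Qed.

Lemma corep_tens1 w m (C : 'I_n -> 'M[L]_w) :
  is_corep iota C -> is_corep iota (fun i => C i *t (1%:M : 'M_m)).
Proof.
case=> CC C1; split=> [i j|].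
  rewrite tensmx_mul mul1mx CC tensmx_suml.
  by apply: eq_bigr => l _; rewrite tensmxZl.
rewrite -tensmx11 -C1 tensmx_suml.
by apply: eq_bigr => l _; rewrite tensmxZl.
Qed.

Lemma tens1_corep w m (C : 'I_n -> 'M[L]_w) :
  is_corep iota C -> is_corep iota (fun i => (1%:M : 'M_m) *t C i).
Proof.
case=> CC C1; split=> [i j|].
  rewrite tensmx_mul mul1mx CC tensmx_sumr.
  by apply: eq_bigr => l _; rewrite tensmxZr.
rewrite -tensmx11 -C1 tensmx_sumr.
by apply: eq_bigr => l _; rewrite tensmxZr.
Qed.

(** On the tensor product of a module and a comodule, R (x) 1 and 1 (x) C commute, so
    [det_canonical] applies. *)
Lemma det_tens_canonical w v (R : H -> 'M[L]_w) (C : 'I_n -> 'M[L]_v) :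
  is_rep iota R -> is_corep iota C ->
  \det (\sum_(l < n) R (e l) *t C l) ^+ n = 1.
Proof.
move=> rR cC; rewrite -[RHS](det_canonical (rep_tens1 v rR) (tens1_corep w cC)).
  by congr (\det _ ^+ _); apply: eq_bigr => l _; rewrite tensmx_mul mul1mx mulmx1.
by move=> h i; rewrite !tensmx_mul !mul1mx !mulmx1.
Qed.

Lemma det_canonical_tens w v (R : H -> 'M[L]_w) (C : 'I_n -> 'M[L]_v) :
  is_rep iota R -> is_corep iota C ->
  \det (\sum_(l < n) C l *t R (e l)) ^+ n = 1.
Proof.
move=> rR cC; rewrite -[RHS](det_canonical (tens1_rep v rR) (corep_tens1 w cC)).
  by congr (\det _ ^+ _); apply: eq_bigr => l _; rewrite tensmx_mul mul1mx mulmx1.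
by move=> h i; rewrite !tensmx_mul !mul1mx !mulmx1.
Qed.

Lemma det_coact_mull w (C : 'I_n -> 'M[L]_w) : is_corep iota C -> \det (coact_mull iota C) ^+ n = 1.
Proof. by move=> cC; exact: det_tens_canonical (regR_rep H iota) cC. Qed.

Lemma det_comul_actr w (R : H -> 'M[L]_w) : is_rep iota R -> \det (comul_actr iota R) ^+ n = 1.
Proof. by move=> rR; exact: det_canonical_tens rR (regC_corep H iota). Qed.

Section Inverse.
Variables (Sb : 'End(H)) (SbK : cancel Sb S) (SK : cancel S Sb).

Lemma antipode_invM a b : Sb (a * b) = Sb b * Sb a.
Proof. by apply: (can_inj SK); rewrite antipodeM !SbK. Qed.

Lemma antipode_inv1 : Sb 1 = 1.
Proof. by rewrite -(antipode1 H) SK antipode1. Qed.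

Lemma sw_antipode_inv (W : lmodType L) (f : H -> H -> W) a :
    (forall y, klin iota (f^~ y)) -> (forall x, klin iota (f x)) ->
  sw f (Sb a) = sw (fun x y => f (Sb y) (Sb x)) a.
Proof.
move=> fl fr; rewrite -{2}[a]SbK sw_antipode; last 2 first.
- by solve_klin.
- by solve_klin.
by apply: eq_sw => x y; rewrite !SK.
Qed.

Lemma det_coact_mulr w (C : 'I_n -> 'M[L]_w) : is_corep iota C -> \det (coact_mulr iota C) ^+ n = 1.
Proof.
move=> cC.
(* The inverse operator h S^-1(m_1) (x) m_0 comes from a module structure on H. *)
pose R a := mxlin (fun h => colv (h * Sb a)).
have RE a h : R a *m colv h = colv (h * Sb a) by rewrite mxlinE //; solve_klin.
have rR : is_rep iota R.
  split=> [a x y||x y]; apply: (@eq_mul_colv k H L iota) => h.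
  - by rewrite mulmxDl -scalemxAl !RE linearP mulrDr -scalerAr lcol.
  - by rewrite RE antipode_inv1 mulr1 mul1mx.
  by rewrite -mulmxA !RE antipode_invM mulrA.
suff TX : coact_mulr iota C *m (\sum_(l < n) R (e l) *t C l) = 1%:M.
  have := congr1 (fun A : 'M_(_) => \det A ^+ n) TX.
  by rewrite det_mulmx exprMn det_tens_canonical // mulr1 det1 expr1n.
apply: (@eq_mul_tens k H L iota) => h; rewrite -mulmxA mul1mx op_tens; last by move=> l; solve_klin.
rewrite mulmx_sumr; under eq_bigr => l _ do rewrite coact_mulr_tens.
rewrite exchange_big /=.
transitivity (\sum_(l < n) sw (fun x y => colv (h * (Sb y * x)) *t (C l *m 1%:M)) (e l)).
  rewrite (corep_sum (fun x y M => colv (h * (Sb y * x)) *t (M *m 1%:M)) cC); last by solve_linearL.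
  by apply: eq_bigr => i _; apply: eq_bigr => j _; rewrite !mulmxA mulrA.
transitivity (\sum_(l < n) iota (counit (e l)) *: (colv h *t (C l *m 1%:M))).
  apply: eq_bigr => l _; rewrite -[in RHS](mulr1 h) -antipode_inv1.
  rewrite -(sw_antil (fun z => colv (h * Sb z) *t (C l *m 1%:M))); last by solve_klin.
  by apply: eq_sw => x y; rewrite antipode_invM SK.
rewrite (corep_unit (fun M => colv h *t (M *m 1%:M)) cC); last by solve_linearL.
by rewrite mulmx1.
Qed.

End Inverse.
End AntiYetterDrinfeld.

Section Key.
Variables (k : fieldType) (H : hopfAlgType k).
Variables (L : fieldType) (iota : {rmorphism k -> L}).
Local Notation n := (\dim {:H}).
Local Notation e i := (vbasis {:H})`_i.
Local Notation S := (@antipode k H).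
Local Notation sw := (@sweedler k H L iota _).
Local Notation colv := (@colv k H L iota).
Local Notation cof i h := (iota (coord (vbasis {:H}) i h)).
Let lcol : klin iota colv := @colv_klin k H L iota.

Section Inverse.
Variables (Sb : 'End(H)) (SbK : cancel Sb S) (SK : cancel S Sb).

Lemma counit_antipode_inv h : counit (Sb h) = counit h.
Proof. by rewrite -{2}[h]SbK counit_antipode. Qed.

Lemma det_comul_actl w (R : H -> 'M[L]_w) : is_rep iota R -> \det (comul_actl iota R) ^+ n = 1.
Proof.
move=> rR; have [lR R1 RM] := rR.
(* The inverse operator h_2 (x) S^-1(h_1) m comes from a comodule structure on H. *)
pose C i := mxlin (sw (fun x y => cof i (Sb x) *: colv y)) : 'M[L]_n.
have CE i h : C i *m colv h = sw (fun x y => cof i (Sb x) *: colv y) h.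
  by rewrite mxlinE //; exact: klin_sw.
have coord_lin p (i j : 'I_n) (B : 'M[L]_(n, p)) :
    klin iota (fun z => iota ((coprod (Sb z) : 'M[k]_(_, _)) i j) *: B).
  by apply: klin_scalel => a u v; rewrite !linearP !mxE.
have cC : is_corep iota C.
  split=> [i j|].
    apply: (@eq_mul_colv k H L iota) => h; rewrite -mulmxA CE sw_mulmxl.
    transitivity (sw (fun x y => sw (fun a b => cof i (Sb a) *: (cof j (Sb x) *: colv b)) y) h).
      apply: eq_sw => x y; rewrite -scalemxAr CE sw_scale.
      by apply: eq_sw => a b; rewrite scalerA mulrC -scalerA.
    rewrite -sw_coassoc mulmx_suml.
    have E x y : sw (fun x a => cof i (Sb a) *: (cof j (Sb x) *: colv y)) x =
       \sum_(l < n) iota ((coprod (e l) : 'M[k]_(_, _)) i j) *: (cof l (Sb x) *: colv y).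
      rewrite -(sw_antipode_inv SbK SK (f := fun u v => cof i u *: (cof j v *: colv y))); last 2 first.
      - by move=> u; solve_klin.
      - by move=> u; solve_klin.
      rewrite sw_coord.
      under eq_bigr => l _ do rewrite scalerA mulrC -scalerA.
      rewrite (@cofK k H L iota _ (fun z => iota ((coprod z : 'M[k]_(_, _)) i j) *: colv y)) //.
      by apply: klin_scalel => a u v; rewrite !linearP !mxE.
    under eq_sw => x y do rewrite E.
    rewrite -sw_sum; apply: eq_bigr => l _.
    by rewrite -scalemxAl CE sw_scale.
  apply: (@eq_mul_colv k H L iota) => h; rewrite mul1mx mulmx_suml.
  under eq_bigr => i _ do rewrite -scalemxAl CE sw_scale.
  rewrite sw_sum -[RHS](@sw_counitl k H L iota _ colv) //; apply: eq_sw => x y.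
  under eq_bigr => i _ do rewrite scalerA mulrC -scalerA.
  rewrite (@cofK k H L iota _ (fun z => iota (counit z) *: colv y)) ?counit_antipode_inv //.
  by apply: klin_scalel => a u v; rewrite linearP.
suff PX : comul_actl iota R *m (\sum_(l < n) C l *t R (e l)) = 1%:M.
  have := congr1 (fun A : 'M_(_) => \det A ^+ n) PX.
  by rewrite det_mulmx exprMn (det_canonical_tens rR cC) mulr1 det1 expr1n.
apply: (@eq_mul_tens k H L iota) => h; rewrite -mulmxA mul1mx.
have -> : (\sum_(l < n) C l *t R (e l)) *m (colv h *t (1%:M : 'M_w)) =
    sw (fun x y => colv y *t (R (Sb x) *m (1%:M : 'M_w))) h.
  rewrite mulmx_suml; under eq_bigr => l _ do rewrite tensmx_mul CE sw_tensl.
  rewrite sw_sum; apply: eq_sw => x y.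
  rewrite (klin_basis (Sb x) lR) mulmx_suml tensmx_sumr; apply: eq_bigr => l _.
  by rewrite tensmxZl -scalemxAl tensmxZr.
rewrite sw_mulmxl.
under eq_sw => x y do rewrite comul_actl_tens //.
rewrite -sw_coassoc.
transitivity (sw (fun x y => iota (counit x) *: (colv y *t (1%:M : 'M_w))) h).
  apply: eq_sw => x y; rewrite -[in RHS]R1 -(antipode_inv1 SK) -(mulmx1 (R (Sb 1))).
  rewrite -(sw_antir (fun z => colv y *t (R (Sb z) *m 1%:M)) x); last by solve_klin.
  by apply: eq_sw => u v; rewrite (antipode_invM SbK SK) SK RM mulmxA.
by rewrite (sw_counitl (fun y => colv y *t 1%:M)) //; solve_klin.
Qed.

End Inverse.

(* Anti-Yetter-Drinfeld modules: left modules and right comodules M with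
   (h m)_0 (x) (h m)_1 = h_2 m_0 (x) h_3 m_1 S(h_1). *)
Record is_ayd w (R : H -> 'M[L]_w) (C : 'I_n -> 'M[L]_w) : Prop := IsAyd {
  ayd_rep : is_rep iota R;
  ayd_corep : is_corep iota C;
  ayd_compat : forall i h, C i *m R h =
    sw (fun x r => sw (fun y z =>
      \sum_(j < n) cof i (z * e j * S x) *: (R y *m C j)) r) h
}.

(* m |-> m_1 m_0 *)
Definition theta w (R : H -> 'M[L]_w) (C : 'I_n -> 'M[L]_w) : 'M[L]_w :=
  \sum_(l < n) R (e l) *m C l.

(** Summing over i reassembles the element of H from its coordinates, which turns the coordinatewise
    compatibility into (h m)_0 (x) (h m)_1 = h_2 m_0 (x) h_3 m_1 S(h_1) tested against [G]. *)
Lemma ayd_sum w (R : H -> 'M[L]_w) (C : 'I_n -> 'M[L]_w) (W : lmodType L)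
    (G : H -> 'M_w -> W) h : is_ayd R C ->
    (forall M, klin iota (G^~ M)) -> (forall x, linear (G x)) ->
  \sum_(i < n) G (e i) (C i *m R h) =
  sw (fun x r => sw (fun y z =>
    \sum_(j < n) G (z * e j * S x) (R y *m C j)) r) h.
Proof.
move=> [_ _ compat] lG linG.
transitivity (\sum_(i < n) sw (fun x r => sw (fun y z =>
   \sum_(j < n) cof i (z * e j * S x) *: G (e i) (R y *m C j)) r) h).
  apply: eq_bigr => i _; rewrite compat (linear_sw _ _ _ (linG _)).
  apply: eq_sw => x r; rewrite (linear_sw _ _ _ (linG _)).
  apply: eq_sw => y z; rewrite (@klin_sumE L L idfun _ _ (G (e i)) _ _ _ _ (linG _)).
  by apply: eq_bigr => j _; rewrite (@klinZ L L idfun _ _ (G (e i)) (linG _)).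
rewrite sw_sum; apply: eq_sw => x r; rewrite sw_sum; apply: eq_sw => y z.
rewrite exchange_big; apply: eq_bigr => j _ /=.
by rewrite (@cofK k H L iota _ (fun u => G u (R y *m C j))).
Qed.
End Key.

(** * Centrality of theta and the determinant identity *)

Section Theta.
Variables (k : fieldType) (H : hopfAlgType k).
Variables (L : fieldType) (iota : {rmorphism k -> L}).
Local Notation n := (\dim {:H}).
Local Notation e i := (vbasis {:H})`_i.
Local Notation S := (@antipode k H).
Local Notation sw := (@sweedler k H L iota _).
Local Notation colv := (@colv k H L iota).
Local Notation cof i h := (iota (coord (vbasis {:H}) i h)).
Let lcol : klin iota colv := @colv_klin k H L iota.

Variables (w : nat) (R : H -> 'M[L]_w) (C : 'I_n -> 'M[L]_w).
Hypothesis M : is_ayd iota R C.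

(** theta(h m) = h_3 m_1 S(h_1) h_2 m_0, in which S(h_1) h_2 cancels. *)
Lemma thetaR h : theta R C *m R h = R h *m theta R C.
Proof.
have [[lR R1 RM] cC _] := M.
rewrite mulmx_suml; under eq_bigr => i _ do rewrite -mulmxA.
rewrite (ayd_sum (G := fun x A => R x *m A) h M); last 2 first.
- by move=> A; solve_klin.
- by move=> x; solve_linearL.
rewrite -sw_coassoc.
transitivity (sw (fun u z => iota (counit u) *: (R z *m theta R C)) h); last first.
  by rewrite (sw_counitl (fun z => R z *m theta R C)) //; solve_klin.
apply: eq_sw => u z; rewrite -sw_sum mulmx_sumr scaler_sumr; apply: eq_bigr => j _.
transitivity (iota (counit u) *: (R (z * e j * 1) *m C j)); last first.
  by rewrite mulr1 RM mulmxA.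
rewrite -(sw_antil (fun v => R (z * e j * v) *m C j)); last by solve_klin.
by apply: eq_sw => x y; rewrite mulmxA -RM !mulrA.
Qed.

(** Both sides give the p-th coordinate of m_1 m_0 (x) m_2. Coacting on m_1 m_0 produces m_1
    m_0-type terms with an extra factor m_1 S(m_2), which [E] removes. *)
Lemma thetaC p : theta R C *m C p = C p *m theta R C.
Proof.
have [[lR R1 RM] cC compat] := M.
have E z : \sum_(a < n) \sum_(j < n) cof p (z * e j * S (e a)) *: (C j *m C a) =
    cof p z *: 1%:M.
  rewrite exchange_big.
  transitivity (\sum_(l < n) sw (fun x y => cof p (z * (x * S y)) *: C l) (e l)).
    rewrite (corep_sum (fun x y A => cof p (z * (x * S y)) *: A) cC); last by solve_linearL.
    by apply: eq_bigr => i _; apply: eq_bigr => j _; rewrite mulrA.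
  transitivity (\sum_(l < n) iota (counit (e l)) *: (cof p z *: C l)).
    apply: eq_bigr => l _; rewrite (sw_antir (fun x => cof p (z * x) *: C l)) ?mulr1 //.
    by apply: klin_scalel => a u v; rewrite mulrDr -scalerAr linearP.
  by rewrite (corep_unit (fun A => cof p z *: A) cC) //; solve_linearL.
transitivity (\sum_(b < n) sw (fun y z => cof p z *: (R y *m C b)) (e b)).
  rewrite (corep_sum (fun y z A => cof p z *: (R y *m A)) cC); last by solve_linearL.
  rewrite mulmx_suml; apply: eq_bigr => i _.
  rewrite (bigD1 p) //= coord_vbasis_elt eqxx rmorph1 scale1r big1 ?addr0 ?mulmxA //.
  by move=> j nj; rewrite coord_vbasis_elt eq_sym (negPf nj) rmorph0 scale0r.
rewrite mulmx_sumr; symmetry.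
under eq_bigr => i _ do rewrite mulmxA compat sw_mulmxr.
under eq_bigr => i _ do under eq_sw => x r do rewrite sw_mulmxr.
transitivity (\sum_(i < n) \sum_(b < n) sw (fun y z => \sum_(j < n)
   (cof p (z * e j * S (e i)) *: (R y *m C j)) *m (C i *m C b)) (e b)).
  rewrite -(corep_sum (fun x r A => sw (fun y z => \sum_(j < n)
   (cof p (z * e j * S x) *: (R y *m C j)) *m A) r) cC); last by solve_linearL.
  by apply: eq_bigr => l _; apply: eq_sw => x r; apply: eq_sw => y z; rewrite mulmx_suml.
rewrite exchange_big; apply: eq_bigr => b _ /=; rewrite sw_sum; apply: eq_sw => y z.
transitivity (R y *m (\sum_(a < n) \sum_(j < n) cof p (z * e j * S (e a)) *: (C j *m C a)) *m C b).
  rewrite mulmx_sumr mulmx_suml; apply: eq_bigr => i _.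
  rewrite mulmx_sumr mulmx_suml; apply: eq_bigr => j _.
  by rewrite -scalemxAl -scalemxAr -scalemxAl !mulmxA.
by rewrite E -scalemxAr mulmx1 scalemxAl.
Qed.

Variables (Sb : 'End(H)) (SbK : cancel Sb S) (SK : cancel S Sb).

(** Both sides send h (x) m to h_2 m_1 (x) a h_1 m_0. On the left, h_2 m_2 (x) h_1 m_1 m_0 contains
    theta(m_0). On the right, the coaction on h_2 m creates S(h_2) next to S^2(h_1), and S(h_2)
    S^2(h_1) = S(S(h_1) h_2) cancels; this is where S^2 is forced. *)
Lemma key_identity (a : L) : theta R C = a%:M ->
  comul_actl iota R *m coact_mulr iota C =
  coact_mull iota C *m (mxlin (fun h => colv (S (S h))) *t a%:M) *m comul_actr iota R.
Proof.
have [[lR R1 RM] cC compat] := M.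
move=> tha; apply: (@eq_mul_tens k H L iota) => h.
transitivity (sw (fun b z => \sum_(j < n) colv (z * e j) *t (R b *m (a%:M *m C j))) h).
  rewrite -mulmxA coact_mulr_tens mulmx_sumr.
  transitivity (\sum_(j < n) sw (fun u v => sw (fun b z =>
      colv (z * v) *t (R (b * u) *m C j)) h) (e j)).
    apply: eq_bigr => j _; rewrite comul_actl_tens // mulmx1 swM; last 2 first.
    - by move=> y; solve_klin.
    - by move=> y; solve_klin.
    by rewrite sw_sw.
  rewrite (corep_sum (fun u v A => sw (fun b z =>
      colv (z * v) *t (R (b * u) *m A)) h) cC); last by solve_linearL.
  rewrite exchange_big /= -sw_sum; apply: eq_bigr => j _; rewrite sw_sum.
  apply: eq_sw => b z; rewrite -tensmx_sumr -tha mulmx_suml mulmx_sumr.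
  by congr (_ *t _); apply: eq_bigr => i _; rewrite RM !mulmxA.
rewrite -!mulmxA comul_actr_tens // !sw_mulmxl.
(* The legs x, p, b, z are h_1, h_2, h_3, h_4; the inserted S(p) S(S(x)) sums to a counit. *)
transitivity (sw (fun x y => sw (fun p r => sw (fun b z => \sum_(j < n)
   colv (z * e j * (S p * S (S x))) *t (R b *m (a%:M *m C j))) r) y) h).
  rewrite -sw_coassoc.
  pose F z' := sw (fun b z => \sum_(j < n) colv (z * e j) *t (R b *m (a%:M *m C j))) z'.
  transitivity (sw (fun u r => iota (counit u) *: F r) h).
    by rewrite (sw_counitl F) //; exact: klin_sw.
  apply: eq_sw => u r; rewrite /F sw_scale.
  transitivity (sw (fun b z => sw (fun x p => \sum_(j < n)
    colv (z * e j * (S p * S (S x))) *t (R b *m (a%:M *m C j))) u) r); last by rewrite sw_sw.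
  apply: eq_sw => b z; rewrite scaler_sumr -sw_sum; apply: eq_bigr => j _.
  rewrite -[z * e j in LHS]mulr1 -(antipode1 H).
  rewrite -(sw_antil (fun q => colv (z * e j * S q) *t (R b *m (a%:M *m C j)))); last by solve_klin.
  by apply: eq_sw => x p; rewrite antipodeM.
apply: eq_sw => x y.
rewrite tensmx_mul mxlinE; last by solve_klin.
rewrite coact_mull_tens.
transitivity (\sum_(i < n) colv (e i * S (S x)) *t ((C i *m R y) *m a%:M)).
  rewrite (ayd_sum (G := fun q A => colv (q * S (S x)) *t (A *m a%:M)) y M); last 2 first.
  - by move=> A; solve_klin.
  - by move=> q; solve_linearL.
  apply: eq_sw => p r; apply: eq_sw => b z; apply: eq_bigr => j _.
  by rewrite !mulrA -mulmxA -scalar_mxC.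
by apply: eq_bigr => i _; rewrite mulmx1 -mulmxA -scalar_mxC.
Qed.

(** The n-th powers of the four other determinants in [key_identity] are 1; on a space of dimension
    n w the scalar a contributes a^(n w), and S^2 is repeated w times. *)
Lemma theta_scalar_det (a : L) : theta R C = a%:M ->
  (a ^+ (n * w) * \det (mxlin (fun h => colv (S (S h)))) ^+ w) ^+ n = 1.
Proof.
move=> tha; have [rR cC _] := M.
have := congr1 (fun A : 'M_(_) => \det A ^+ n) (key_identity tha).
rewrite !det_mulmx !exprMn (det_comul_actl SbK SK) // (det_coact_mulr SbK SK) //.
rewrite det_coact_mull // det_comul_actr //.
rewrite !(mul1r, mulr1) => E.
rewrite -scalemx1 tensmxZr detZ det_tensmx1 in E.
by rewrite -exprMn -E.
Qed.
End Theta.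

(** * Free anti-Yetter-Drinfeld modules *)

Section Free.
Variables (k : fieldType) (H : hopfAlgType k).
Variables (L : fieldType) (iota : {rmorphism k -> L}).
Local Notation n := (\dim {:H}).
Local Notation e i := (vbasis {:H})`_i.
Local Notation S := (@antipode k H).
Local Notation sw := (@sweedler k H L iota _).
Local Notation colv := (@colv k H L iota).
Local Notation regR := (@regR k H L iota).
Local Notation cof i h := (iota (coord (vbasis {:H}) i h)).
Let lcol : klin iota colv := @colv_klin k H L iota.

(* Coefficients of the coaction g |-> g_2 (x) g_3 u S(g_1). *)
Definition adjK (u : H) (i : 'I_n) : 'M[L]_n :=
  mxlin (sw (fun x r => sw (fun y z => cof i (z * u * S x) *: colv y) r)).

Lemma adjK_col u i h : adjK u i *m colv h =
  sw (fun x r => sw (fun y z => cof i (z * u * S x) *: colv y) r) h.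
Proof. by rewrite mxlinE //; exact: klin_sw. Qed.

Lemma coprod_coord_sum (W : lmodType L) (i j : 'I_n) (B : W) h :
  \sum_(l < n) iota ((coprod (e l) : 'M[k]_(_, _)) i j) *: (cof l h *: B) =
  sw (fun x y => cof i x *: (cof j y *: B)) h.
Proof.
under eq_bigr => l _ do rewrite scalerA mulrC -scalerA.
rewrite sw_coord (@cofK k H L iota _ (fun h => iota ((coprod h : 'M[k]_(_, _)) i j) *: B)) //.
by apply: klin_scalel => a u v; rewrite linearP !mxE.
Qed.

(** Coassociativity of the free coaction, before V enters. Both sides are the (i, j) coordinate of
    g_3 (x) g_4 u_1 S(g_2) (x) g_5 u_2 S(g_1); the reversed order of g_1 and g_2 comes from
    [sw_antipode]. *)
Lemma adjKM u i j : sw (fun x y => adjK x i *m adjK y j) u =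
  \sum_(l < n) iota ((coprod (e l) : 'M[k]_(_, _)) i j) *: adjK u l.
Proof.
apply: (@eq_mul_colv k H L iota) => g.
pose T p a b c z := sw (fun x y => cof i (c * x * S a) *: (cof j (z * y * S p) *: colv b)) u.
transitivity (sw (fun P r => sw (fun b Z => sw (fun c z => sw (fun p a =>
    T p a b c z) P) Z) r) g); last first.
  rewrite mulmx_suml; symmetry.
  under eq_bigr => l _ do rewrite -scalemxAl adjK_col sw_scale.
  rewrite sw_sum; apply: eq_sw => P r.
  under eq_bigr => l _ do rewrite sw_scale.
  rewrite sw_sum; apply: eq_sw => b Z.
  rewrite coprod_coord_sum.
  rewrite swM; last 2 first.
  - by move=> y; solve_klin.
  - by move=> x; apply: klinZf; solve_klin.
  rewrite swM; last 2 first.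
  - by move=> y; solve_klin.
  - by move=> x; solve_klin.
  apply: eq_sw => c z; rewrite /T sw_sw sw_antipode; last 2 first.
  - by move=> q; solve_klin.
  - by move=> q; solve_klin.
  by [].
rewrite sw_mulmxr.
transitivity (sw (fun x y => sw (fun p r => sw (fun q z => sw (fun a s =>
  sw (fun b c => cof i (c * x * S a) *: (cof j (z * y * S p) *: colv b)) s) q) r) g) u).
  apply: eq_sw => x y; rewrite -mulmxA adjK_col sw_mulmxl; apply: eq_sw => p r.
  rewrite sw_mulmxl; apply: eq_sw => q z; rewrite -scalemxAr adjK_col sw_scale.
  apply: eq_sw => a s; rewrite sw_scale; apply: eq_sw => b c.
  by rewrite scalerA mulrC -scalerA.
transitivity (sw (fun p r => sw (fun q z => sw (fun a s => sw (fun b c =>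
  T p a b c z) s) q) r) g).
  rewrite sw_sw; apply: eq_sw => p r; rewrite sw_sw; apply: eq_sw => q z.
  by rewrite sw_sw; apply: eq_sw => a s; rewrite sw_sw.
transitivity (sw (fun p r => sw (fun a r' => sw (fun b Z => sw (fun c z =>
  T p a b c z) Z) r') r) g).
  apply: eq_sw => p r; rewrite sw_coassoc; apply: eq_sw => a r'.
  by rewrite sw_coassoc.
rewrite -sw_coassoc; apply: eq_sw => P r'; rewrite sw_sw; apply: eq_sw => b Z.
by rewrite sw_sw.
Qed.

Lemma sum_counit_adjK u : \sum_(i < n) iota (counit (e i)) *: adjK u i =
  (iota (counit u))%:M.
Proof.
apply: (@eq_mul_colv k H L iota) => g; rewrite mulmx_suml.
under eq_bigr => l _ do rewrite -scalemxAl adjK_col sw_scale.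
rewrite sw_sum.
transitivity (sw (fun x r => iota (counit u) *: (iota (counit x) *: colv r)) g).
  apply: eq_sw => x r.
  under eq_bigr => l _ do rewrite sw_scale.
  rewrite sw_sum.
  transitivity (sw (fun y z => iota (counit z) *: (iota (counit u) *: (iota (counit x) *: colv y))) r).
    apply: eq_sw => y z.
    under eq_bigr => l _ do rewrite scalerA mulrC -scalerA.
    rewrite (@cofK k H L iota _ (fun h => iota (counit h) *: colv y)) //; last by solve_klin.
    by rewrite !counitM counit_antipode !rmorphM !scalerA.
  by rewrite (sw_counitr (fun y => iota (counit u) *: (iota (counit x) *: colv y))) //; solve_klin.
by rewrite -sw_scale (sw_counitl colv) // mul_scalar_mx.
Qed.

(** The compatibility of [is_ayd], before V enters: (h g)_3 u S((h g)_1) = h_3 (g_3 u S(g_1))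
    S(h_1). *)
Lemma adjK_regR u i h : adjK u i *m regR h =
  sw (fun x r => sw (fun y z =>
    \sum_(j < n) cof i (z * e j * S x) *: (regR y *m adjK u j)) r) h.
Proof.
apply: (@eq_mul_colv k H L iota) => g; rewrite -mulmxA regR_col adjK_col.
transitivity (sw (fun x r => sw (fun y z => sw (fun x' r' => sw (fun y' z' =>
    cof i (z * (z' * u * S x') * S x) *: colv (y * y')) r') g) r) h).
  rewrite swM; last 2 first.
  - by move=> y; solve_klin.
  - by move=> x; solve_klin.
  apply: eq_sw => x r; rewrite [RHS]sw_sw; apply: eq_sw => x' r'.
  rewrite swM; last 2 first.
  - by move=> y; solve_klin.
  - by move=> y; solve_klin.
  apply: eq_sw => y z; apply: eq_sw => y' z'.
  by rewrite antipodeM !mulrA.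
rewrite sw_mulmxr; apply: eq_sw => x r; rewrite sw_mulmxr; apply: eq_sw => y z.
rewrite mulmx_suml.
under [RHS]eq_bigr => j _ do rewrite -scalemxAl -mulmxA adjK_col sw_mulmxl sw_scale.
rewrite sw_sum; apply: eq_sw => x' r'.
under [RHS]eq_bigr => j _ do rewrite sw_mulmxl sw_scale.
rewrite sw_sum; apply: eq_sw => y' z'.
under eq_bigr => j _ do rewrite -scalemxAr regR_col scalerA mulrC -scalerA.
by rewrite (@cofK k H L iota _ (fun q => cof i (z * q * S x) *: colv (y * y'))) //; solve_klin.
Qed.

Section FreeModule.
Variables (v : nat) (C : 'I_n -> 'M[L]_v).
Hypothesis cC : is_corep iota C.

(* The free anti-Yetter-Drinfeld module V (x) H on a comodule V:
   v (x) g |-> (v_0 (x) g_2) (x) g_3 v_1 S(g_1). *)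
Definition freeC (i : 'I_n) : 'M[L]_(v * n) := \sum_(a < n) C a *t adjK (e a) i.

Lemma free_ayd : is_ayd iota (fun h => (1%:M : 'M_v) *t regR h) freeC.
Proof.
split.
- exact/tens1_rep/regR_rep.
- split=> [i j|].
    rewrite mulmx_suml.
    under eq_bigr => a _ do (rewrite mulmx_sumr; under eq_bigr => b _ do rewrite tensmx_mul).
    rewrite -(corep_sum (fun x y A => A *t (adjK x i *m adjK y j)) cC); last by solve_linearL.
    under [RHS]eq_bigr => l _ do rewrite scaler_sumr.
    rewrite [RHS]exchange_big; apply: eq_bigr => a _ /=; rewrite -sw_tensr adjKM tensmx_sumr.
    by apply: eq_bigr => l _; rewrite tensmxZr.
  under eq_bigr => l _ do rewrite scaler_sumr.
  rewrite exchange_big -tensmx11 -(corep_unit (fun A => A *t 1%:M) cC); last by solve_linearL.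
  apply: eq_bigr => a _; rewrite -tensmxZr scalemx1 -sum_counit_adjK tensmx_sumr.
  by apply: eq_bigr => l _; rewrite tensmxZr.
move=> i h; rewrite mulmx_suml.
under eq_bigr => a _ do rewrite tensmx_mul mulmx1 adjK_regR sw_tensr.
rewrite sw_sum; apply: eq_sw => x r.
under eq_bigr => a _ do rewrite sw_tensr.
rewrite sw_sum; apply: eq_sw => y z.
under eq_bigr => a _ do rewrite tensmx_sumr.
rewrite exchange_big; apply: eq_bigr => j _ /=.
rewrite mulmx_sumr scaler_sumr; apply: eq_bigr => a _.
by rewrite tensmx_mul mul1mx tensmxZr.
Qed.

(** theta(v (x) g) = v_0 (x) g_3 v_1 S(g_1) g_2, in which S(g_1) g_2 cancels and leaves v_0 (x) g
    v_1. *)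
Lemma theta_free : theta (fun h => (1%:M : 'M_v) *t regR h) freeC =
  \sum_(a < n) C a *t mxlin (fun h => colv (h * e a)).
Proof.
rewrite /theta; under eq_bigr => l _ do rewrite mulmx_sumr.
rewrite exchange_big; apply: eq_bigr => a _ /=.
under eq_bigr => l _ do rewrite tensmx_mul mul1mx.
rewrite -tensmx_sumr; congr (_ *t _); apply: (@eq_mul_colv k H L iota) => g.
rewrite mulmx_suml mxlinE; last by solve_klin.
under eq_bigr => l _ do rewrite -mulmxA adjK_col sw_mulmxl.
rewrite sw_sum.
transitivity (sw (fun x r => sw (fun y z => colv (z * e a * (S x * y))) r) g).
  apply: eq_sw => x r.
  under eq_bigr => l _ do rewrite sw_mulmxl.
  rewrite sw_sum; apply: eq_sw => y z.
  under eq_bigr => l _ do rewrite -scalemxAr regR_col.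
  by rewrite (@cofK k H L iota _ (fun q => colv (q * y))) ?mulrA //; solve_klin.
rewrite -sw_coassoc -[RHS](@sw_counitl k H L iota _ (fun z => colv (z * e a))); last by solve_klin.
apply: eq_sw => b z; rewrite (sw_antil (fun q => colv (z * e a * q))) ?mulr1 //.
by solve_klin.
Qed.

End FreeModule.
End Free.

(** * Eigenvalues of Theta and of the convolution operator N *)

Section Eigenspace.
Variables (k : fieldType) (H : hopfAlgType k).
Variables (L : fieldType) (iota : {rmorphism k -> L}).
Local Notation n := (\dim {:H}).
Local Notation e i := (vbasis {:H})`_i.
Local Notation S := (@antipode k H).
Local Notation sw := (@sweedler k H L iota _).
Local Notation colv := (@colv k H L iota).
Local Notation regR := (@regR k H L iota).
Local Notation regC := (@regC k H L iota).
Let lcol : klin iota colv := @colv_klin k H L iota.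

(** Modules consist of columns, so a row-free [U] is a map onto L^d: the new module is a quotient of
    the old one. Quotients fit here because [eigenspace] consists of row vectors. *)
Lemma ayd_restrict w d (R : H -> 'M[L]_w) (C : 'I_n -> 'M[L]_w)
    (R' : H -> 'M[L]_d) (C' : 'I_n -> 'M[L]_d) (U : 'M_(d, w)) :
    is_ayd iota R C -> row_free U ->
    (forall h, U *m R h = R' h *m U) -> (forall i, U *m C i = C' i *m U) ->
  is_ayd iota R' C'.
Proof.
move=> [[lR R1 RM] [CM C1] compat] Ufree UR UC.
have inj m := row_free_inj Ufree : injective ((@mulmx _ m _ _)^~ U).
split.
- split=> [a x y||x y]; apply: inj.
  + by rewrite mulmxDl -scalemxAl -!UR lR mulmxDr scalemxAr.
  + by rewrite -UR R1 mulmx1 mul1mx.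
  by rewrite -mulmxA -!UR mulmxA -UR -mulmxA RM.
- split=> [i j|]; apply: inj.
    rewrite -mulmxA -UC mulmxA -UC -mulmxA CM mulmx_sumr mulmx_suml.
    by apply: eq_bigr => l _; rewrite -scalemxAr -scalemxAl UC.
  rewrite mul1mx -[RHS]mulmx1 -C1 mulmx_sumr mulmx_suml.
  by apply: eq_bigr => l _; rewrite -scalemxAr -scalemxAl UC.
move=> i h; apply: inj; rewrite -mulmxA -UR mulmxA -UC -mulmxA compat.
rewrite sw_mulmxl sw_mulmxr; apply: eq_sw => x r.
rewrite sw_mulmxl sw_mulmxr; apply: eq_sw => y z.
rewrite mulmx_sumr mulmx_suml; apply: eq_bigr => j _.
by rewrite -scalemxAr -scalemxAl -mulmxA -UC !mulmxA UR.
Qed.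

Lemma ayd_eigenvalue_det w (R : H -> 'M[L]_w) (C : 'I_n -> 'M[L]_w) a :
    is_ayd iota R C -> eigenvalue (theta R C) a ->
  exists2 d, (0 < d)%N &
    (a ^+ (n * d) * \det (mxlin (fun h => colv (S (S h)))) ^+ d) ^+ n = 1.
Proof.
move=> ayd ev; pose E := eigenspace (theta R C) a; pose U := row_base E.
exists (\rank E); first by rewrite lt0n mxrank_eq0.
have Ufree : row_free U by apply: row_base_free.
(* The matrix induced by [G] on the quotient; [resE] confirms this when [G] commutes with theta,
   since [G] then stabilizes the row eigenspace. *)
pose res G := U *m G *m pinvmx U.
have resE G : theta R C *m G = G *m theta R C -> U *m G = res G *m U.
  move=> cG; rewrite mulmxKpV //.
  have sE : stablemx E G by exact: comm_mx_stable_eigenspace.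
  by rewrite (eqmxMr _ (eq_row_base E)) (submx_trans sE) // eq_row_base.
have ayd' : is_ayd iota (fun h => res (R h)) (fun i => res (C i)).
  apply: (ayd_restrict ayd Ufree) => [h|i]; apply: resE.
    exact: (thetaR ayd).
  exact: (thetaC ayd).
have [Sb [SbK SK]] := antipode_bij H.
apply: (theta_scalar_det ayd' SbK SK).
apply: (row_free_inj Ufree); rewrite mul_scalar_mx.
have -> : a *: U = U *m theta R C by apply/esym/eigenspaceP; rewrite eq_row_base.
rewrite mulmx_suml mulmx_sumr; apply: eq_bigr => l _.
rewrite -mulmxA -resE; last exact: (thetaC ayd).
by rewrite mulmxA -resE ?mulmxA //; exact: (thetaR ayd).
Qed.

(* x (x) y |-> x_1 (x) y x_2, which is theta of the free module on the regular
   comodule. *)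
Definition free_theta : 'M[L]_(n * n) :=
  \sum_(a < n) regC a *t mxlin (fun h => colv (h * e a)).

(* x (x) y |-> x_1 (x) x_2 y, i.e. convolution by the identity. *)
Definition convol_op : 'M[L]_(n * n) := \sum_(a < n) regC a *t regR (e a).

Lemma free_theta_col x y : free_theta *m (colv x *t colv y) =
  sw (fun u v => colv u *t colv (y * v)) x.
Proof.
rewrite mulmx_suml.
under eq_bigr => a _.
  rewrite tensmx_mul regC_col mxlinE; last by solve_klin.
  rewrite sw_tensl.
  over.
rewrite sw_sum; apply: eq_sw => u v.
under eq_bigr => a _ do rewrite tensmxZl.
by rewrite (@cofK k H L iota _ (fun v => colv u *t colv (y * v))) //; solve_klin.
Qed.

Lemma convol_op_col x y : convol_op *m (colv x *t colv y) =
  sw (fun u v => colv u *t colv (v * y)) x.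
Proof.
rewrite mulmx_suml.
under eq_bigr => a _ do rewrite tensmx_mul regC_col regR_col sw_tensl.
rewrite sw_sum; apply: eq_sw => u v.
under eq_bigr => a _ do rewrite tensmxZl.
by rewrite (@cofK k H L iota _ (fun v => colv u *t colv (v * y))) //; solve_klin.
Qed.

(** x (x) y goes to x_1 (x) y x_2, then to x_1 (x) S(x_2) S(y), then to x_1 (x) x_2 S(x_3) S(y),
    which is x (x) S(y). *)
Lemma convol_op_antipode (s := (1%:M : 'M_n) *t mxlin (fun h => colv (S h))) :
  convol_op *m s *m free_theta = s.
Proof.
have sE x y : s *m (colv x *t colv y) = colv x *t colv (S y).
  by rewrite tensmx_mul mul1mx mxlinE //; solve_klin.
apply: (@eq_mul_tens_col k H L iota) => x y.
rewrite -!mulmxA free_theta_col sE !sw_mulmxl.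
transitivity (sw (fun u v => sw (fun p q => colv p *t colv (q * (S v * S y))) u) x).
  by apply: eq_sw => u v; rewrite sE convol_op_col antipodeM.
rewrite sw_coassoc -[RHS](@sw_counitr k H L iota _ (fun x => colv x *t colv (S y))); last by solve_klin.
apply: eq_sw => p q.
under eq_sw => u v do rewrite mulrA.
by rewrite (sw_antir (fun u => colv p *t colv (u * S y))) ?mul1r //; solve_klin.
Qed.

(** The fixed vector 1 (x) 1 is a column whereas [eigenvalue] concerns rows, hence the detour: were
    [free_theta - 1%:M] invertible, 1 (x) 1 would vanish, but the counit on both factors maps it to
    1. *)
Lemma free_theta_eigenvalue1 : eigenvalue free_theta 1.
Proof.
rewrite /eigenvalue /eigenspace kermx_eq0 row_free_unit; apply/negP => U.
have fixed : (free_theta - 1%:M) *m (colv 1 *t colv 1) = 0.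
  rewrite mulmxBl mul1mx free_theta_col (@sw1 k H L iota) ?mulr1 ?subrr //.
    by solve_klin.
  by solve_klin.
have := mulKmx U (colv 1 *t colv 1 : 'cV_(n * n)); rewrite fixed mulmx0 => /esym v0.
pose g (x y : H) := iota (counit x) *: (iota (counit y) *: 1%:M) : 'cV[L]_1.
have := congr1 (mulmx (mx2 g)) v0.
rewrite mulmx0 (@mx2E k H L iota); last 2 first.
- by move=> y; rewrite /g; solve_klin.
- by move=> x; rewrite /g; solve_klin.
rewrite /g counit1 rmorph1 !scale1r => /matrixP/(_ 0 0)/eqP.
by rewrite !mxE oner_eq0.
Qed.

End Eigenspace.

Lemma convol_op_eigenvalue_root_of_unity (k : fieldType) (H : hopfAlgType k)
    (L : fieldType) (iota : {rmorphism k -> L}) (x : L) :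
  eigenvalue (convol_op H iota) x -> exists2 m, (0 < m)%N & x ^+ m = 1.
Proof.
pose n : nat := \dim {:H}; pose s := mxlin (fun h : H => colv iota (antipode h)).
pose t := (1%:M : 'M[L]_n) *t s.
case/eigenvalueP=> y yN y0.
have tu : t \in unitmx.
  by rewrite unitmxE det_tens1mx unitrX // -unitmxE mxlin_antipode_unit.
(* From N t Theta = t: the row [y *m t] is an eigenvector of Theta for the inverse of x. *)
have E : x *: (y *m t *m free_theta H iota) = y *m t.
  by rewrite !scalemxAl -yN -!mulmxA; congr (y *m _); rewrite mulmxA; exact: convol_op_antipode.
have yt0 : y *m t != 0.
  by apply: contraNneq y0 => yt; rewrite -(mulmxK tu y) yt mul0mx.
have x0 : x != 0 by apply: contraNneq yt0 => x0; rewrite -E x0 scale0r.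
have evx : eigenvalue (free_theta H iota) x^-1.
  apply/eigenvalueP; exists (y *m t) => //.
  by rewrite -[in RHS]E scalerA mulVf // scale1r.
have ayd := free_ayd (regC_corep H iota).
have th := theta_free iota (regC iota (H := H)).
have ev a : eigenvalue (free_theta H iota) a -> exists2 d, (0 < d)%N &
    (a ^+ (n * d) * \det (mxlin (fun h : H => colv iota (antipode (antipode h)))) ^+ d) ^+ n = 1.
  by move=> eva; apply: (ayd_eigenvalue_det ayd); rewrite th.
have [d d0 Ed] := ev _ evx.
have [d1 d10 Ed1] := ev _ (free_theta_eigenvalue1 H iota).
move: Ed Ed1; set D := \det _; rewrite expr1n mul1r => Ed Ed1.
have n0 : (0 < n)%N.
  case: (posnP n) => // n0; case/negP: y0; apply/eqP/rowP => i.
  have : (0 < n * n)%N by apply: leq_ltn_trans (ltn_ord i).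
  by rewrite n0.
(* The relation for the inverse of x is raised to the power d1, because D^(n d1) = 1, the relation
   for the eigenvalue 1, then eliminates D. *)
exists (n * d * (n * d1))%N; first by rewrite !muln_gt0 n0 d0 d10.
have := congr1 (fun z => z ^+ d1) Ed; rewrite !exprMn expr1n -!exprM.
have -> : D ^+ (d * (n * d1)) = 1.
  by rewrite mulnC [(n * d1)%N]mulnC exprM exprM Ed1 expr1n.
rewrite mulr1 exprVn => /(congr1 (@GRing.inv _)).
by rewrite invrK invr1.
Qed.

(** * From the characteristic polynomial of N to the recurrence of the indicators *)

Lemma Cayley_Hamilton_sum (R : comNzRingType) m (A : 'M[R]_m) :
  \sum_(i < size (char_poly A)) (char_poly A)`_i *: iter i (mulmx A) 1%:M = 0.
Proof.
case: m A => [|m] A; first by apply/matrixP => -[].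
rewrite -[RHS](Cayley_Hamilton A) -[in RHS](coefK (char_poly A)) poly_def.
rewrite rmorph_sum; apply: eq_bigr => i _ /=.
rewrite linearZ /= rmorphXn /= horner_mx_X; congr (_ *: _).
by elim: (i : nat) => //= j ->; rewrite exprS.
Qed.

Lemma iter_mulmxD (R : comNzRingType) m (A : 'M[R]_m) i j :
  iter (i + j) (mulmx A) 1%:M = iter i (mulmx A) 1%:M *m iter j (mulmx A) 1%:M.
Proof.
by elim: i => [|i IHi]; rewrite ?mul1mx // addSn !iterS IHi mulmxA.
Qed.

Lemma ltrace_coord (k : fieldType) (V : vectType k) (f : 'End(V)) :
  ltrace f = \sum_i coord (vbasis {:V}) i (f (vbasis {:V})`_i).
Proof.
by apply: eq_bigr => i _; rewrite mxE /= passmx.vecof_delta mxE.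
Qed.

Lemma colv_map (k : fieldType) (H : hopfAlgType k) (L : fieldType)
    (iota : {rmorphism k -> L}) (h : H) :
  colv iota h = map_mx iota (colv idfun h).
Proof. by apply/matrixP=> i j; rewrite !mxE. Qed.

Section Indicators.
Variables (k : fieldType) (H : hopfAlgType k).
Local Notation n := (\dim {:H}).
Local Notation colv := (@colv k H k idfun).
Local Notation sw := (@sweedler k H k idfun _).
Local Notation N := (@convol_op k H k idfun).
Let lcol : klin idfun colv := @colv_klin k H k idfun.

Lemma iter_convol_op_col m h : iter m (mulmx N) 1%:M *m (colv h *t colv 1) =
  sw (fun x y => colv x *t colv (convol_pow_id H m y)) h.
Proof.
elim: m => [|m IHm].
  rewrite mul1mx -[LHS](@sw_counitr k H k idfun _ (fun x => colv x *t colv 1)).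
    by apply: eq_sw => x y; rewrite convol_unitE (klinZ lcol) tensmxZr.
  by solve_klin.
rewrite iterS -mulmxA IHm sw_mulmxl.
under eq_sw => x y do rewrite convol_op_col.
rewrite sw_coassoc; apply: eq_sw => x y.
rewrite /= convolE (klin_tlift _ _ lcol) -/(sw _ _) sw_tensr.
by apply: eq_sw => u v; rewrite id_lfunE.
Qed.

(** Composing N^m with h |-> h (x) 1 before and with the counit on the first factor after gives
    P^(m); F then applies S and takes the trace. The shift m.+1 matches the convolution power n - 1
    in the indicator. *)
Lemma hopf_indicator_trace : exists2 F : 'M[k]_(n * n) -> k,
  linear (F : _ -> k^o) & forall m, hopf_indicator H m.+1 = F (iter m (mulmx N) 1%:M).
Proof.
pose E := mx2 (fun x y : H => counit x *: colv y).
pose U := mxlin (fun h => colv h *t colv 1) : 'M[k]_(n * n, n).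
pose s := mxlin (fun h : H => colv (antipode h)).
exists (fun X => \tr (s *m (E *m (X *m U)))).
  by move=> a A B; rewrite mulmxDl !mulmxDr -scalemxAl -!scalemxAr linearP.
move=> m; rewrite /hopf_indicator ltrace_coord; apply: eq_bigr => i _.
have -> : s *m (E *m (iter m (mulmx N) 1%:M *m U)) =
    mxlin (fun h => colv (antipode (convol_pow_id H m h))).
  apply: (@eq_mul_colv k H k idfun) => h; rewrite -!mulmxA.
  rewrite (@mxlinE k H k idfun _ (fun h => colv h *t colv 1)); last first.
    exact: (klin_tensl (colv 1) lcol).
  rewrite iter_convol_op_col sw_mulmxl.
  under eq_sw => x y.
    rewrite (@mx2E k H k idfun); last 2 first.
    - by move=> z a u v; rewrite linearP scalerDl scalerA.
    - by move=> z; solve_klin.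
    over.
  rewrite (@sw_counitl k H k idfun _ (fun y => colv (convol_pow_id H m y))); last by solve_klin.
  by rewrite !mxlinE //; solve_klin.
by rewrite !mxE comp_lfunE.
Qed.

Lemma char_poly_convol_op_rec : satisfies_rec (@hopf_indicator k H) (char_poly N).
Proof.
have [F linF FE] := hopf_indicator_trace.
pose b := GRing.isLinear.Build _ _ _ _ _ linF.
pose FL : {linear 'M[k]_(n * n) -> k^o} := HB.pack F b.
(* Since the sequence starts at index 1, position j.+1 corresponds to N^j, and the recurrence is F
   applied to N^j times the characteristic polynomial evaluated at N. *)
move=> [//|j] _.
under eq_bigr => i _ do rewrite addSn FE iter_mulmxD.
rewrite -[RHS](linear0 FL) -(mulmx0 _ (iter j (mulmx N) 1%:M)) -(Cayley_Hamilton_sum N).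
rewrite mulmx_sumr linear_sum; apply: eq_bigr => i _.
by rewrite -scalemxAr linearZ.
Qed.

(** Links the two instances of the development: over k, where the recurrence lives, and over L,
    where the eigenvalues lie. *)
Lemma map_convol_op (L : fieldType) (iota : {rmorphism k -> L}) :
  map_mx iota N = convol_op H iota.
Proof.
apply: (@eq_mul_tens_col k H L iota) => x y.
rewrite convol_op_col !(colv_map iota) -map_mxT -map_mxM convol_op_col.
rewrite (klin_sw_id (iota := iota)).
  by apply: eq_sw => u v; rewrite map_mxT !(colv_map iota).
by move=> a A B; rewrite map_mxD map_mxZ.
Qed.

End Indicators.

Theorem theorem4p1 (k : fieldType) (H : hopfAlgType k) (phi : {poly k})
    (phi_min : is_seq_minpoly (@hopf_indicator k H) phi)
    (L : closedFieldType) (iota : {rmorphism k -> L})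
    (algL : forall x : L, algebraicOver iota x)
    (x : L) (phi_x : root (map_poly iota phi) x) :
  exists2 n : nat, (0 < n)%N & n.-unity_root x.
Proof.
have [_ /(_ (char_poly (convol_op H idfun)))[/(_ (@char_poly_convol_op_rec k H)) phi_dvd _]] := phi_min.
have [m m_gt0 xm] : exists2 m, (0 < m)%N & x ^+ m = 1.
  apply: (@convol_op_eigenvalue_root_of_unity k H L iota).
  rewrite eigenvalue_root_char -map_convol_op -map_char_poly.
  by apply: root_dvdp phi_x; rewrite dvdp_map.
by exists m => //; rewrite unity_rootE xm.
Qed.
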